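(* Let $\ddot H=\overset{N=4}{\ddot H}(\Lambda^{(2)(1,0)(\mathrm I)}_{0,0})$, the non-irreducible N=4 superconformal module of central charge $-9$ obtained with $M=2$, $m=1$, $m_2=0$, $k_1=k_2=0$. Put $D(\tau,z)=\prod_{n=1}^\infty(1-e^{4\pi iz}q^{n-1})(1-e^{-4\pi iz}q^n)$. Then: 1) (i) $\mathrm{ch}^{(+)}_{\ddot H}(\tau,z)=i\,\dfrac{\vartheta_{00}(\tau,z)}{\vartheta_{11}(\tau,2z)}=-q^{-\frac18}e^{2\pi iz}\,\dfrac{\prod_{n=1}^\infty(1+e^{2\pi iz}q^{n-\frac12})(1+e^{-2\pi iz}q^{n-\frac12})}{D(\tau,z)}$; (ii) $\mathrm{ch}^{(-)}_{\ddot H}(\tau,z)=i\,\dfrac{\vartheta_{01}(\tau,z)}{\vartheta_{11}(\tau,2z)}=-q^{-\frac18}e^{2\pi iz}\,\dfrac{\prod_{n=1}^\infty(1-e^{2\pi iz}q^{n-\frac12})(1-e^{-2\pi iz}q^{n-\frac12})}{D(\tau,z)}$. 2) (i) $\mathrm{ch}^{(+)\mathrm{tw}}_{\ddot H}(\tau,z)=i\,\dfrac{\vartheta_{10}(\tau,z)}{\vartheta_{11}(\tau,2z)}=-e^{\pi iz}\,\dfrac{\prod_{n=1}^\infty(1+e^{2\pi iz}q^{n-1})(1+e^{-2\pi iz}q^{n})}{D(\tau,z)}$; (ii) $\mathrm{ch}^{(-)\mathrm{tw}}_{\ddot H}(\tau,z)=\dfrac{\vartheta_{11}(\tau,z)}{\vartheta_{11}(\tau,2z)}=e^{\pi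 iz}\,\dfrac{\prod_{n=1}^\infty(1-e^{2\pi iz}q^{n-1})(1-e^{-2\pi iz}q^{n})}{D(\tau,z)}$.
   Context: $q=e^{2\pi i\tau}$, $q^a=e^{2\pi ia\tau}$; $\vartheta_{ab}(\tau,z)=\sum_{n\in\mathbf Z}e^{\pi i(n+\frac a2)^2\tau+2\pi i(n+\frac a2)(z+\frac b2)}$ (Mumford), $\eta(\tau)=q^{1/24}\prod_{n\ge1}(1-q^n)$. Affine superalgebra. $\widehat A(1,1)$ is the affine Lie superalgebra of $sl(2|2)/\mathbf CI$ with simple roots $\alpha_0,\alpha_2$ (even), $\alpha_1,\alpha_3$ (odd), and $(\alpha_0|\alpha_0)=2$, $(\alpha_2|\alpha_2)=-2$, $(\alpha_1|\alpha_1)=(\alpha_3|\alpha_3)=(\alpha_1|\alpha_3)=(\alpha_0|\alpha_2)=0$, $(\alpha_0|\alpha_1)=(\alpha_0|\alpha_3)=-1$, $(\alpha_1|\alpha_2)=(\alpha_2|\alpha_3)=1$ (so $\alpha_1,\alpha_3$ coincide as functions on the Cartan subalgebra). $\delta=\sum_{i=0}^3\alpha_i$, $\theta=\alpha_1+\alpha_2+\alpha_3$, $(\Lambda_0|\alpha_j)=\delta_{j,0}$, $(\Lambda_0|\Lambda_0)=0$, $\rho=-\frac12(\alpha_1+\alpha_3)$, dual Coxeter number $0$. The Cartan subalgebra is identified with its dual via $(\cdot|\cdot)$, with coordinates $(\tau,z_1,z_2,t)=2\pi i(-\tau\Lambda_0+z+t\delta)$, $z=-\frac{z_1-z_2}2(\alpha_1+\alpha_3)-z_1\alpha_2$;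 thus $e^{-\alpha_1}=e^{-\alpha_3}=e^{2\pi iz_1}$, $e^{-\alpha_2}=e^{-2\pi i(z_1+z_2)}$, $e^{\Lambda_0}=e^{2\pi it}$, $e^{-\delta}=q$. Put $t_\alpha(\lambda)=\lambda+(\lambda|\delta)\alpha-\{\frac{(\alpha|\alpha)}2(\lambda|\delta)+(\lambda|\alpha)\}\delta$, $r_\theta(\lambda)=\lambda-(\lambda|\theta)\theta$, $r_{\alpha_2}(\lambda)=\lambda+(\lambda|\alpha_2)\alpha_2$, and $w.\lambda=w(\lambda+\rho)-\rho$. Characters of modules. All characters are normalized (super)characters ($+$: character, $-$: supercharacter), $\widehat R^{(\pm)}$ is the (super)denominator, and ''numerator'' means the product $\widehat R^{(\pm)}\mathrm{ch}^{(\pm)}$. They are given by the following formulas. For $0\le m_2\le m$ let $\Lambda^{(m,m_2)}=m\Lambda_0+\frac{m_2}2(\alpha_1+\alpha_3)$ and $F^{(\pm)}=\sum_{j\in\mathbf Z}t_{j\theta}\Big(\frac{e^{\Lambda^{(m,m_2)}+\rho}}{(1\pm e^{-\alpha_1})(1\pm e^{-\alpha_3})}\Big)$; then $\widehat R^{(\pm)}\mathrm{ch}^{(\pm)}_{L(\Lambda^{(m,m_2)})}=F^{(\pm)}-r_\theta F^{(\pm)}$. For integers $k_1,k_2\ge0$ with $2k_1+k_2\le M-1$ (type I) put $\beta=-\frac{2k_1+k_2}2(\alpha_1+\alpha_3)-k_1\alpha_2$. The principal admissible weight is $\Lambda^{(M)(m,m_2)(\mathrm I)}_{k_1,k_2}=t_\beta.(\Lambda^{(m,m_2)}-(M-1)\frac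 mM\Lambda_0)$ and its irreducible highest weight module has $[\widehat R^{(\pm)}\mathrm{ch}^{(\pm)}_{L(\Lambda^{(M)(m,m_2)(\mathrm I)}_{k_1,k_2})}](\tau,z,t)=[\widehat R^{(\pm)}\mathrm{ch}^{(\pm)}_{L(\Lambda^{(m,m_2)})}]\big(M\tau,z+\tau\beta,\frac1M(t+(z|\beta)+\frac{\tau|\beta|^2}2)\big)$. Twisted functions are $f^{\mathrm{tw}}(h)=f(w_0h)$ with $w_0=r_{\alpha_2}t_{-\frac12\alpha_2}$, i.e. $w_0(\tau,z_1,z_2,t)=(\tau,-z_2+\frac\tau2,-z_1+\frac\tau2,t+\frac{z_1+z_2}2-\frac\tau4)$. For $0\le m_2\le m-1$, $\ddot L(\Lambda^{(M)(m,m_2)(\mathrm I)}_{k_1,k_2})=L(\Lambda^{(M)(m,m_2)(\mathrm I)}_{k_1,k_2})\oplus L(\Lambda^{(M)(m,m_2+1)(\mathrm I)}_{k_1,k_2})$, with $\mathrm{ch}^{(\pm)}_{\ddot L}=\mathrm{ch}^{(\pm)}_{L(\Lambda^{(M)(m,m_2)(\mathrm I)}_{k_1,k_2})}\pm\mathrm{ch}^{(\pm)}_{L(\Lambda^{(M)(m,m_2+1)(\mathrm I)}_{k_1,k_2})}$ and the same for twisted characters. N=4 characters. $\overset{N=4}{\ddot H}(\Lambda)$ is the quantum Hamiltonian reduction of $\ddot L(\Lambda)$ for $(x=\frac12\theta,f=e_{-\theta})$, a module of the N=4 superconformal algebra of central charge $-6(\frac mM+1)$. Its characters are given by $[\overset{N=4}R{}^{(\pm)}\mathrm{ch}^{(\pm)}_{\ddot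 H}](\tau,z)=[\widehat R^{(\pm)}\mathrm{ch}^{(\pm)}_{\ddot L}](\tau,z+\frac\tau2,z-\frac\tau2,\frac\tau4)$, and likewise with ''tw'' throughout, where the N=4 denominators are $\overset{N=4}R{}^{(+)}=-i\frac{\eta(\tau)^3\vartheta_{11}(\tau,2z)}{\vartheta_{00}(\tau,z)^2}$, $\overset{N=4}R{}^{(-)}=i\frac{\eta(\tau)^3\vartheta_{11}(\tau,2z)}{\vartheta_{01}(\tau,z)^2}$, $\overset{N=4}R{}^{(+)\mathrm{tw}}=-i\frac{\eta(\tau)^3\vartheta_{11}(\tau,2z)}{\vartheta_{10}(\tau,z)^2}$, $\overset{N=4}R{}^{(-)\mathrm{tw}}=i\frac{\eta(\tau)^3\vartheta_{11}(\tau,2z)}{\vartheta_{11}(\tau,z)^2}$. *)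

(* Defs.v *)
From mathcomp Require Import all_boot all_order all_algebra.
From mathcomp Require Import complex ring.
From mathcomp Require Import all_classical all_reals all_analysis.

Set Implicit Arguments.
Unset Strict Implicit.
Unset Printing Implicit Defensive.

Import Order.TTheory GRing.Theory Num.Theory.
Import numFieldNormedType.Exports.

Local Open Scope complex_scope.
Local Open Scope ring_scope.

(* R[i] carries its topology through its numFieldType structure. *)
Section Limits.
Variable K : numFieldType.

(* Every bilateral series below converges absolutely where it is used, so its
   value does not depend on how the two halves are summed. *)
Definition sumZ (f : int -> K) : K :=
  lim ((fun N : nat => \sum_(0 <= n < N) f (Posz n)) @ \oo)%classic
  + lim ((fun N : nat => \sum_(0 <= n < N) f (Negz n)) @ \oo)%classic.

Definition prod_ge1 (u : nat -> K) : K :=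
  lim ((fun N : nat => \prod_(1 <= n < N.+1) u n) @ \oo)%classic.

End Limits.

Section Functions.
Variable R : realType.
Local Notation C := R[i].
Implicit Types (tau z : C).

Definition cexp z : C :=
  (expR (complex.Re z) * cos (complex.Im z))
    +i* (expR (complex.Re z) * sin (complex.Im z)).

Definition piC : C := (pi : R)%:C.

Definition tpi : C := 2 * piC * 'i%C.

Definition e2pi z : C := cexp (tpi * z).

Definition qpow tau (a : C) : C := e2pi (a * tau).

Definition theta (a b : nat) tau z : C :=
  sumZ (fun n : int =>
    cexp (piC * 'i%C * (n%:~R + a%:R / 2) ^+ 2 * tau
          + tpi * (n%:~R + a%:R / 2) * (z + b%:R / 2))).

Definition eta tau : C :=
  qpow tau (24%:R^-1) * prod_ge1 (fun n => 1 - qpow tau n%:R).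

End Functions.

Section AffineA11.
Variable R : realType.
Local Notation C := R[i].

(* The dual of the Cartan subalgebra of A(1,1)^, identified with the Cartan
   subalgebra by the bilinear form, in the basis (Lambda0, alpha1, alpha2,
   delta); alpha3 is the same vector as alpha1. *)
Local Notation cartan := 'rV[C]_4.

Implicit Types (x y h lam z : cartan).

Definition Lambda0 : cartan := delta_mx 0 0.
Definition alpha1 : cartan := delta_mx 0 1.
Definition alpha2 : cartan := delta_mx 0 2.
Definition delta : cartan := delta_mx 0 3.
Definition alpha3 : cartan := alpha1.
Definition alpha0 : cartan := delta - alpha1 - alpha2 - alpha3.

Definition bform x y : C :=
  x 0 0 * y 0 3 + x 0 3 * y 0 0
  + x 0 1 * y 0 2 + x 0 2 * y 0 1 - 2 * x 0 2 * y 0 2.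

Lemma form_simple_roots :
  [/\ [/\ bform alpha0 alpha0 = 2, bform alpha2 alpha2 = - 2,
          bform alpha1 alpha1 = 0, bform alpha3 alpha3 = 0
        & bform alpha1 alpha3 = 0],
      [/\ bform alpha0 alpha2 = 0, bform alpha0 alpha1 = - 1,
          bform alpha0 alpha3 = - 1, bform alpha1 alpha2 = 1
        & bform alpha2 alpha3 = 1]
    & [/\ bform Lambda0 Lambda0 = 0, bform Lambda0 alpha0 = 1,
          bform Lambda0 alpha1 = 0, bform Lambda0 alpha2 = 0
        & bform Lambda0 alpha3 = 0]].
Proof.
by rewrite /bform /alpha0 /alpha3; split; split; rewrite !mxE /=; ring.
Qed.

Definition theta_root : cartan := alpha1 + alpha2 + alpha3.

Definition rho : cartan := - 2^-1 *: (alpha1 + alpha3).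

Definition transl (alpha lam : cartan) : cartan :=
  lam + bform lam delta *: alpha
  - (bform alpha alpha / 2 * bform lam delta + bform lam alpha) *: delta.

Definition refl_theta lam : cartan := lam - bform lam theta_root *: theta_root.

Definition refl_alpha2 lam : cartan := lam + bform lam alpha2 *: alpha2.

Definition zvec (z1 z2 : C) : cartan :=
  - ((z1 - z2) / 2) *: (alpha1 + alpha3) - z1 *: alpha2.

Definition hpoint (tau : C) z (t : C) : cartan :=
  tpi R *: (- tau *: Lambda0 + z + t *: delta).

(* Inverse coordinates: h = hpoint (tau_of h) (z_of h) (t_of h). *)
Definition tau_of h : C := - bform h delta / tpi R.
Definition t_of h : C := bform h Lambda0 / tpi R.
Definition z_of h : cartan :=
  (tpi R)^-1 *: h + tau_of h *: Lambda0 - t_of h *: delta.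

Definition expf lam h : C := cexp (bform lam h).

(* In all that follows [super = false] is the sign "+" (characters) and
   [super = true] the sign "-" (supercharacters). *)
Definition sgn (super : bool) : C := (-1) ^+ super.

Definition Lambda (m m2 : nat) : cartan :=
  m%:R *: Lambda0 + (m2%:R / 2) *: (alpha1 + alpha3).

(* An isometry w acts on functions by (w f)(h) = f (w^-1 h), so that
   w e^lam = e^(w lam); the inverse of t_(j theta) is t_(- j theta), and
   r_theta is an involution. *)
Definition Fsum (super : bool) (m m2 : nat) h : C :=
  let f h' := expf (Lambda m m2 + rho) h'
    / ((1 + sgn super * expf (- alpha1) h')
       * (1 + sgn super * expf (- alpha3) h')) in
  sumZ (fun j : int => f (transl (- j%:~R *: theta_root) h)).

Definition numer (super : bool) (m m2 : nat) h : C :=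
  Fsum super m m2 h - Fsum super m m2 (refl_theta h).

Definition beta (k1 k2 : nat) : cartan :=
  - ((2 * k1 + k2)%:R / 2) *: (alpha1 + alpha3) - k1%:R *: alpha2.

(* Numerator of the module of highest weight
   t_beta.(Lambda m m2 - (M - 1) (m / M) Lambda0), for 2 k1 + k2 <= M - 1;
   the weight enters only through the parameters M, m, m2, k1, k2. *)
Definition numer_adm (super : bool) (M m m2 k1 k2 : nat) h : C :=
  let tau := tau_of h in
  let z := z_of h in
  let t := t_of h in
  let b := beta k1 k2 in
  numer super m m2
    (hpoint (M%:R * tau) (z + tau *: b)
       (M%:R^-1 * (t + bform z b + tau * bform b b / 2))).

Definition numer_ddot (super : bool) (M m m2 k1 k2 : nat) h : C :=
  numer_adm super M m m2 k1 k2 h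
  + sgn super * numer_adm super M m m2.+1 k1 k2 h.

Definition w0 h : cartan := refl_alpha2 (transl (- 2^-1 *: alpha2) h).

Definition twist (f : cartan -> C) h : C := f (w0 h).

Definition R_N4 (super : bool) (tau z : C) : C :=
  if super
  then 'i%C * (eta tau ^+ 3 * theta 1 1 tau (2 * z) / theta 0 1 tau z ^+ 2)
  else - 'i%C * (eta tau ^+ 3 * theta 1 1 tau (2 * z) / theta 0 0 tau z ^+ 2).

Definition R_N4_tw (super : bool) (tau z : C) : C :=
  if super
  then 'i%C * (eta tau ^+ 3 * theta 1 1 tau (2 * z) / theta 1 1 tau z ^+ 2)
  else - 'i%C * (eta tau ^+ 3 * theta 1 1 tau (2 * z) / theta 1 0 tau z ^+ 2).

Definition N4_point (tau z : C) : cartan :=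
  hpoint tau (zvec (z + tau / 2) (z - tau / 2)) (tau / 4).

(* Characters of the quantum reduction of
   L(Lambda^(M)(m,m2)(I)_(k1,k2)) (+) L(Lambda^(M)(m,m2+1)(I)_(k1,k2)). *)
Definition ch_N4 (super : bool) (M m m2 k1 k2 : nat) (tau z : C) : C :=
  numer_ddot super M m m2 k1 k2 (N4_point tau z) / R_N4 super tau z.

Definition ch_N4_tw (super : bool) (M m m2 k1 k2 : nat) (tau z : C) : C :=
  twist (numer_ddot super M m m2 k1 k2) (N4_point tau z) / R_N4_tw super tau z.

Definition Dprod (tau z : C) : C :=
  prod_ge1 (fun n => (1 - e2pi (2 * z) * qpow tau (n%:R - 1))
                     * (1 - e2pi (- 2 * z) * qpow tau n%:R)).

End AffineA11.

(* Main.v *)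
Require Import Defs.
From mathcomp Require Import all_boot all_order all_algebra.
From mathcomp Require Import complex ring lra zify.
From mathcomp Require Import all_classical all_reals all_analysis.
Import Order.TTheory GRing.Theory Num.Theory.
Import numFieldNormedType.Exports Normc.
Local Open Scope complex_scope.
Local Open Scope ring_scope.

(** Write q for e^(2 pi i tau), x for e^(2 pi i z) and s for the sign + or -.

    For m = 1 the numerators with m2 = 0 and m2 = 1 are sums over j of the same
    Gaussian terms divided by (1 + s u_j)^2, with u_j = x_1 q^j, except that
    the terms with m2 = 0 carry the extra factor u_j.  The combination that
    defines the module therefore has numerators u_j + s = s (1 + s u_j), and
    one of the two factors cancels: all poles become simple.  After q has been
    replaced by q^2 (that is M = 2), the sum and its image under the reflection
    in theta run over the even and the odd indices of one bilateral series
      sum_n (-1)^n q^(n(n+1)/2) / (1 + X q^n)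
    because in both cases the two coordinates z_1, z_2 differ by exactly tau;
    here X = s x q^(1/2) for the module and X = s q / x for its twist
    ([numer_ddot_product]).  This series is the partial fraction expansion of
    the reciprocal of a theta function ([appell_sumZ]):
      (q;q)^2 / prod_(n >= 1) (1 + X q^(n-1)) (1 + X^-1 q^n).
    Jacobi's triple product ([theta_term_sum]) identifies it with eta^3 divided
    by theta_00, theta_01, theta_10 or theta_11 at (tau, z), up to elementary
    factors.  The N=4 denominator contains the inverse square of the same theta
    function, so exactly one theta function survives in the character, over
    theta_11(tau, 2z).  The product formulas are the triple product once more.

    Both q-series identities are limits of finite ones.  The finite triple
    product is the q-binomial theorem, and the finite reciprocal product is a
    partial fraction decomposition.  In both sums the k-th term has the weight
    1 / ((q)_k (q)_(n-k)), so that both follow by induction on n from the two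
    q-Pascal recurrences of this weight.  Recentred at k = n/2, the weights are
    bounded and tend to 1 / (q;q)^2, while the remaining factors decay
    geometrically, and dominated convergence gives the limits.

    All powers q^a and x^a are written as exponentials of a complex exponent,
    since fractional exponents occur; a sign s is then a shift of the exponent
    by pi i, and one computation serves all four characters. *)

Set Implicit Arguments.
Unset Strict Implicit.

Local Notation normc := (@normc _).

(** * Absolutely convergent series and products of complex numbers *)

Section ComplexLimits.
Local Open Scope classical_set_scope.
Local Open Scope ring_scope.
Variable R : realType.
Local Notation C := (R[i] : numFieldType).

Lemma norm_normc (x : R[i]) : `|x| = (normc x)%:C.
Proof. by case: x. Qed.

Lemma normc_ge0 (x : R[i]) : 0 <= normc x.
Proof. by rewrite -lecR -norm_normc; exact: (@normr_ge0 _ R[i]). Qed.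

Lemma normcD_le (x y : R[i]) : normc (x + y) <= normc x + normc y.
Proof. by rewrite -lecR rmorphD/= -!norm_normc; exact: (@ler_normD _ R[i]). Qed.

Lemma normc_sum (I : Type) (s : seq I) (P : pred I) (F : I -> R[i]) :
  normc (\sum_(i <- s | P i) F i) <= \sum_(i <- s | P i) normc (F i).
Proof.
elim/big_rec2: _ => [|i x y _ xy]; first by rewrite (normc0 R).
by apply: le_trans (normcD_le _ _) _; rewrite lerD2l.
Qed.

Lemma normc_prod (I : Type) (s : seq I) (P : pred I) (F : I -> R[i]) :
  normc (\prod_(i <- s | P i) F i) = \prod_(i <- s | P i) normc (F i).
Proof.
by elim/big_rec2: _ => [|i x y _ <-]; rewrite ?normc1 ?normcM.
Qed.

Lemma normcX (x : R[i]) n : normc (x ^+ n) = normc x ^+ n.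
Proof. by elim: n => [|n IH]; rewrite ?expr0 ?normc1// !exprS normcM IH. Qed.

(** The topology of R[i] is defined by its norm, which takes values in R[i]; this
    reduces convergence to that of a sequence of real numbers. *)
Lemma cvgC_normcP (u : nat -> C) (l : C) :
  (u @ \oo --> l)%classic <-> ((fun n => normc (l - u n)) @ \oo --> 0)%classic.
Proof.
split => [/cvgrPdist_lt ul|/cvgrPdist_lt ul]; apply/cvgrPdist_lt => e e0.
  have e0' : (0 : C) < e%:C by rewrite ltcR.
  apply: filterS (ul _ e0') => n.
  by rewrite norm_normc ltcR sub0r normrN ger0_norm ?normc_ge0.
have eE : e = (complex.Re e)%:C by rewrite RRe_real// gtr0_real.
have e0' : 0 < complex.Re e by rewrite eE ltcR in e0.
apply: filterS (ul _ e0') => n.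
by rewrite eE norm_normc ltcR sub0r normrN ger0_norm ?normc_ge0.
Qed.

Lemma cvgC_ReIm (u : nat -> C) (a b : R) :
  ((fun n => complex.Re (u n)) @ \oo --> a)%classic ->
  ((fun n => complex.Im (u n)) @ \oo --> b)%classic ->
  (u @ \oo --> (a +i* b : C))%classic.
Proof.
move=> ua ub; apply/cvgC_normcP.
have ub2 : ((fun n => `|a - complex.Re (u n)| + `|b - complex.Im (u n)|) @ \oo
    --> (0 : R))%classic.
  rewrite -[0]addr0; apply: cvgD.
    by apply/norm_cvg0P; rewrite -[X in _ --> X](subrr a); apply: cvgB ua; apply: cvg_cst.
  by apply/norm_cvg0P; rewrite -[X in _ --> X](subrr b); apply: cvgB ub; apply: cvg_cst.
apply: (squeeze_cvgr _ (cvg_cst 0) ub2); near=> n.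
rewrite normc_ge0/=.
set c := complex.Re (u n); set d := complex.Im (u n).
have -> : a +i* b - u n = (a - c)%:C + (b - d)%:C * 'i%C.
  by rewrite /c /d; case: (u n) => x y; simpc.
apply: le_trans (normcD_le _ _) _; apply: lerD.
  by rewrite /= expr0n/= addr0 sqrtr_sqr.
by rewrite normcM /= !expr0n/= addr0 add0r expr1n sqrtr1 mulr1 sqrtr_sqr.
Unshelve. all: by end_near. Qed.


Definition bounded_seq (u : nat -> C) := exists B : R, forall n, normc (u n) <= B.

(** Domination by a geometric series is the form of absolute convergence used
    throughout: it is stable under products with bounded sequences and it gives
    explicit tails. *)
Definition geom_dom (u : nat -> C) :=
  exists A r : R, [/\ 0 <= r, r < 1 & forall n, normc (u n) <= A * r ^+ n].

Lemma cvg_bounded_seq (u : nat -> C) (l : C) : u @ \oo --> l -> bounded_seq u.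
Proof.
move=> /cvgC_normcP ul.
have [B hB] : exists B : R, forall n, normc (l - u n) <= B.
  have /cvg_seq_bounded/pinfty_ex_gt0[M M0 /= hM] : cvgn (fun n => normc (l - u n)).
    by apply/cvg_ex; exists 0.
  by exists M => n; have := hM n I; rewrite ger0_norm ?normc_ge0.
exists (normc l + B) => n.
have -> : u n = l + - (l - u n) by rewrite opprB addrC subrK.
by apply: le_trans (normcD_le _ _) _; rewrite normcN lerD2l.
Qed.

Lemma bounded_seq_ge0 (u : nat -> C) : bounded_seq u ->
  exists2 B : R, 0 <= B & forall n, normc (u n) <= B.
Proof. by case=> B hB; exists B => //; apply: le_trans (hB 0%N); apply: normc_ge0. Qed.

Lemma geom_dom_ge0 (u : nat -> C) : geom_dom u ->
  exists A r : R, [/\ 0 <= A, 0 <= r, r < 1 & forall n, normc (u n) <= A * r ^+ n].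
Proof.
case=> A [r [r0 r1 h]]; exists A, r; split=> //.
by have := h 0%N; rewrite expr0 mulr1; apply: le_trans; apply: normc_ge0.
Qed.

Lemma geom_domM (w u : nat -> C) : bounded_seq w -> geom_dom u ->
  geom_dom (fun n => w n * u n).
Proof.
move=> /bounded_seq_ge0[B B0 hB] /geom_dom_ge0[A [r [A0 r0 r1 h]]].
exists (B * A), r; split=> // n; rewrite normcM -mulrA.
by apply: ler_pM; rewrite ?normc_ge0.
Qed.

Lemma geom_domD (u v : nat -> C) : geom_dom u -> geom_dom v ->
  geom_dom (fun n => u n + v n).
Proof.
move=> /geom_dom_ge0[A [r [A0 r0 r1 hu]]] /geom_dom_ge0[B [s [B0 s0 s1 hv]]].
exists (A + B), (Num.max r s); split=> [||n].
- by rewrite le_max r0.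
- by rewrite gt_max r1 s1.
apply: le_trans (normcD_le _ _) _; rewrite mulrDl; apply: lerD.
  by apply: le_trans (hu n) _; rewrite ler_wpM2l// lerXn2r ?nnegrE ?le_max ?lexx ?r0.
by apply: le_trans (hv n) _; rewrite ler_wpM2l// lerXn2r ?nnegrE ?le_max ?lexx ?s0 ?orbT.
Qed.

Lemma geom_sum_le (A r : R) m n : 0 <= A -> 0 <= r -> r < 1 ->
  \sum_(m <= k < n) A * r ^+ k <= A * r ^+ m / (1 - r).
Proof.
move=> A0 r0 r1; have r1' : 0 < 1 - r by rewrite subr_gt0.
have pos k : 0 <= A * r ^+ k / (1 - r).
  by apply: divr_ge0; [apply: mulr_ge0 => //; exact: exprn_ge0|exact: ltW].
have [nm|mn] := leqP n m; first by rewrite big_geq.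
rewrite (telescope_sumr_eq (fun k => - (A * r ^+ k / (1 - r)))) ?(ltnW mn)//.
  by rewrite opprK addrC lerBlDr lerDl.
by move=> k _; rewrite exprS; field; rewrite subr_eq0 eq_sym lt_eqF.
Qed.

Lemma geom_dom_cvg0 (u : nat -> C) : geom_dom u -> u @ \oo --> (0 : C).
Proof.
move=> [A [r [r0 r1 h]]]; apply/cvgC_normcP.
have c0 : (fun n => A * r ^+ n) @ \oo --> (0 : R).
  by apply: cvg_geometric; rewrite ger0_norm.
apply: (squeeze_cvgr _ (cvg_cst 0) c0).
by apply: nearW => n; rewrite normc_ge0 sub0r normcN h.
Qed.

Lemma geom_dom_real_cvg (v : nat -> R) (A r : R) : 0 <= r -> r < 1 ->
  (forall n, `|v n| <= A * r ^+ n) -> cvgn (series v).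
Proof.
move=> r0 r1 h; apply: normed_cvg.
apply: (@series_le_cvg R _ (geometric A r)) => [n|n|n|] //=.
  exact: le_trans (h n).
by apply: is_cvg_geometric_series; rewrite ger0_norm.
Qed.

(** Absolute convergence is checked on real and imaginary parts, which reduces it
    to the completeness of R. *)
Lemma geom_dom_series (u : nat -> C) : geom_dom u -> cvgn (series u).
Proof.
move=> [A [r [r0 r1 h]]].
have hRe : cvgn (series (fun n => complex.Re (u n))).
  apply: (geom_dom_real_cvg r0 r1) => n; apply: le_trans (h n).
  by rewrite -lecR -norm_normc; exact: normc_ge_Re.
have hIm : cvgn (series (fun n => complex.Im (u n))).
  apply: (geom_dom_real_cvg r0 r1) => n; apply: le_trans (h n).
  by case: (u n) => a b /=; rewrite -sqrtr_sqr ler_wsqrtr// lerDr sqr_ge0.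
apply/cvg_ex; exists (limn (series (fun n => complex.Re (u n)))
   +i* limn (series (fun n => complex.Im (u n))) : C).
apply: cvgC_ReIm.
  apply: cvg_trans hRe; apply: near_eq_cvg; apply: nearW => n.
  by rewrite /series/= (big_morph (@complex.Re R) (op1 := +%R) (id1 := 0))// => -[? ?] [? ?].
apply: cvg_trans hIm; apply: near_eq_cvg; apply: nearW => n.
by rewrite /series/= (big_morph (@complex.Im R) (op1 := +%R) (id1 := 0))// => -[? ?] [? ?].
Qed.

Lemma cvg_sum0 (v : nat -> nat -> R) (K : nat) :
  (forall k, (fun n => v n k) @ \oo --> (0 : R)) ->
  (fun n => \sum_(k < K) v n k : R) @ \oo --> (0 : R).
Proof.
move=> h; elim: K => [|K IH].
  rewrite (_ : (fun n => _) = fun=> 0); first exact: cvg_cst.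
  by apply/funext => n; rewrite big_ord0.
have hS := cvgD IH (h K); rewrite addr0 in hS.
rewrite (_ : (fun n => _) = (fun n => \sum_(k < K) v n k) + v^~ K); first exact: hS.
by apply/funext => n; rewrite big_ord_recr.
Qed.

(** Split the sum at an index K: the tail is small uniformly in n because it is
    dominated by a geometric tail, and the finitely many terms below K tend to 0. *)
Lemma dominated_series0 (V : nat -> nat -> C) (b : nat -> C) (B : R) :
  geom_dom b -> (forall n k, normc (V n k) <= B) ->
  (forall k, (fun n => V n k) @ \oo --> (0 : C)) ->
  (fun n => \sum_(0 <= k < n) V n k * b k : C) @ \oo --> (0 : C).
Proof.
move=> /geom_dom_ge0[A [r [A0 r0 r1 hb]]] hV V0.
have B0 : 0 <= B by apply: le_trans (hV 0%N 0%N); apply: normc_ge0.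
apply/cvgC_normcP/cvgrPdist_le => e e0.
have r1' : 0 < 1 - r by rewrite subr_gt0.
have e20 : 0 < e / 2 by rewrite divr_gt0.
have tail : (fun K => (B * A) * r ^+ K / (1 - r)) @ \oo --> (0 : R).
  rewrite -[X in _ --> X](mul0r (1 - r)^-1); apply: cvgM; last exact: cvg_cst.
  by apply: cvg_geometric; rewrite ger0_norm.
move/cvgrPdist_le/(_ _ e20) : tail => -[K _ /(_ K (leqnn K))].
rewrite sub0r normrN => /(le_trans (ler_norm _)) hK.
have hd : (fun n => \sum_(k < K) normc (V n k) * (A * r ^+ k) : R) @ \oo --> (0 : R).
  apply: (@cvg_sum0 (fun n k => normc (V n k) * (A * r ^+ k)) K) => k.
  rewrite -[X in _ --> X](mul0r (A * r ^+ k)); apply: cvgM; last exact: cvg_cst.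
  have /cvgC_normcP := V0 k.
  by under eq_fun do rewrite sub0r normcN.
move/cvgrPdist_le/(_ _ e20) : hd => hd.
near=> n.
have Kn : (K <= n)%N by near: n; exact: nbhs_infty_ge.
rewrite sub0r normrN ger0_norm ?normc_ge0// sub0r normcN.
apply: le_trans (normc_sum _ _ _) _.
rewrite (big_cat_nat (leq0n K) Kn)/= (splitr e) lerD//.
  have : `|0 - \sum_(k < K) normc (V n k) * (A * r ^+ k)| <= e / 2.
    by near: n.
  rewrite sub0r normrN => /(le_trans (ler_norm _)); apply: le_trans.
  rewrite big_mkord; apply: ler_sum => k _.
  by rewrite normcM ler_wpM2l ?normc_ge0.
apply: le_trans hK.
apply: (@le_trans _ _ (\sum_(K <= k < n) B * A * r ^+ k)); last first.
  by apply: geom_sum_le => //; rewrite mulr_ge0.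
apply: ler_sum => k _; rewrite normcM -mulrA.
by apply: ler_pM; rewrite ?normc_ge0.
Unshelve. all: by end_near. Qed.

(** Dominated convergence for weights W n k that all tend to the same limit w,
    when the n-th sum is also truncated at n. *)
Lemma dominated_series (W : nat -> nat -> C) (w : C) (b : nat -> C) (B : R) :
  geom_dom b -> (forall n k, normc (W n k) <= B) ->
  (forall k, (fun n => W n k) @ \oo --> w) ->
  (fun n => \sum_(0 <= k < n) W n k * b k : C) @ \oo --> w * limn (series b).
Proof.
move=> hb hW Ww.
have h1 : (fun n => \sum_(0 <= k < n) (W n k - w) * b k : C) @ \oo --> (0 : C).
  apply: (@dominated_series0 (fun n k => W n k - w) b (B + normc w) hb) => [n k|k].
    by apply: le_trans (normcD_le _ _) _; rewrite normcN lerD2r.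
  rewrite -[X in _ --> X](subrr w).
  by apply: cvgB; [apply: Ww|apply: cvg_cst].
have h2 : (fun n => w * series b n) @ \oo --> w * limn (series b).
  by apply: cvgM; [apply: cvg_cst|apply: geom_dom_series].
have h3 := cvgD h1 h2; rewrite add0r in h3.
have -> : (fun n => \sum_(0 <= k < n) W n k * b k : C) =
  (fun n => \sum_(0 <= k < n) (W n k - w) * b k : C) + (fun n => w * series b n).
  apply/funext => n; rewrite /series /= [RHS]/GRing.add/= mulr_sumr -big_split /=.
  by apply: eq_bigr => k _; rewrite mulrBl subrK.
exact: h3.
Qed.

(** The partial products are bounded by the exponential of the geometric series,
    hence their successive differences are dominated by a geometric series. *)
Lemma geom_dom_prod (u : nat -> C) : geom_dom u ->
  cvgn (fun n => \prod_(k < n) (1 + u k) : C).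
Proof.
move=> /[dup] hu /geom_dom_ge0[A [r [A0 r0 r1 h]]].
have [P PE] : exists P : nat -> C, forall n, P n = \prod_(k < n) (1 + u k).
  by eexists.
rewrite (_ : (fun n => _) = P); last by apply/funext => n; rewrite PE.
have bP : bounded_seq P.
  exists (expR (A / (1 - r))) => n; rewrite PE normc_prod.
  apply: (@le_trans _ _ (\prod_(k < n) expR (A * r ^+ k))).
    apply: ler_prod => k _; rewrite normc_ge0/=.
    apply: le_trans (expR_ge1Dx _).
    by apply: le_trans (normcD_le _ _) _; rewrite normc1 lerD2l.
  rewrite -expR_sum ler_expR -(big_mkord predT (fun k => A * r ^+ k)).
  by have := geom_sum_le 0 n A0 r0 r1; rewrite expr0 mulr1.
have : cvgn (series (telescope P)).
  have -> : telescope P = (fun n => P n * u n).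
    by apply/funext => n; rewrite /telescope /= !PE big_ord_recr /= mulrDr mulr1 addrC addKr.
  exact: geom_dom_series (geom_domM bP hu).
move=> /cvg_ex[l hl]; apply/cvg_ex; exists (P 0%N + l).
(* A sequence converges when the series of its differences does. *)
have : P = cst (P 0%N) + series (telescope P).
  by apply/funext => n; rewrite [LHS]eq_sum_telescope.
move: (P 0%N) => c ->.
by apply: cvgD hl; exact: cvg_cst.
Qed.

Lemma geom_dom_inv (u : nat -> C) : geom_dom u -> (forall k, 1 + u k != 0) ->
  bounded_seq (fun n => (1 + u n)^-1).
Proof.
move=> hu u0; apply: (@cvg_bounded_seq _ (1 + 0)^-1); apply: cvgV.
  by rewrite addr0 oner_eq0.
by apply: cvgD; [apply: cvg_cst|apply: geom_dom_cvg0].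
Qed.

(** The inverses of the factors are again of the form 1 + v k with v dominated, so
    the product of the inverses converges too, and the two limits are inverse to
    each other. *)
Lemma geom_dom_prod_neq0 (u : nat -> C) : geom_dom u -> (forall k, 1 + u k != 0) ->
  limn (fun n => \prod_(k < n) (1 + u k) : C) != 0.
Proof.
move=> hu u0.
pose v k := - (1 + u k)^-1 * u k.
have hv : geom_dom v.
  apply: geom_domM => //; have [B hB] := geom_dom_inv hu u0.
  by exists B => n; rewrite normcN.
have vE k : 1 + v k = (1 + u k)^-1 by rewrite /v; field.
have /cvg_ex[p hp] := geom_dom_prod hu; have /cvg_ex[l hl] := geom_dom_prod hv.
have /(_ _) h1 := cvgM hp hl; move: h1.
rewrite (_ : _ \* _ = cst (1 : C)); last first.
  apply/funext => n /=; rewrite -big_split/= big1// => k _.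
  by rewrite vE divff.
move=> /(cvg_lim (@norm_hausdorff _ C)).
rewrite lim_cst; last exact: norm_hausdorff.
rewrite (cvg_lim (@norm_hausdorff _ C) hp) => pl; apply/eqP => p0.
by move/eqP: pl; rewrite p0 mul0r oner_eq0.
Qed.

End ComplexLimits.

(** * Finite q-identities over a field *)

Section FiniteIdentities.
Variables (K : fieldType) (q : K).

(** This is a^n q^(n(n-1)/2); as a product it avoids dividing n(n-1) by 2, and
    estimates of products apply to it. *)
Definition gprod (a : K) (n : nat) : K := \prod_(i < n) (a * q ^+ i).

Definition qfact (n : nat) : K := \prod_(i < n) (1 - q ^+ i.+1).

(** A sum against the weights 1 / ((q)_k (q)_(n-k)), which are the q-binomial
    coefficients divided by (q)_n. *)
Definition qbinsum (n : nat) (a : nat -> K) : K :=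
  \sum_(k < n.+1) a k / (qfact k * qfact (n - k)).

Hypothesis q_neq0 : q != 0.
Hypothesis q_nroot : forall i : nat, 1 - q ^+ i.+1 != 0.

Lemma gprodS a n : gprod a n.+1 = gprod a n * (a * q ^+ n).
Proof. by rewrite /gprod big_ord_recr. Qed.

Lemma gprodD a m n : gprod a (m + n) = gprod a m * gprod (a * q ^+ m) n.
Proof.
rewrite /gprod big_split_ord /=; congr (_ * _); apply: eq_bigr => i _.
by rewrite exprD mulrA.
Qed.

Lemma gprodMq a n : gprod (a * q) n = gprod a n * q ^+ n.
Proof.
by elim: n => [|n IH]; rewrite ?gprodS ?IH /gprod ?big_ord0 ?mulr1// !exprS; ring.
Qed.

Lemma gprod_neq0 a n : a != 0 -> gprod a n != 0.
Proof.
by move=> a0; apply/prodf_neq0 => i _; rewrite mulf_neq0// expf_neq0.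
Qed.

Lemma qfact_neq0 n : qfact n != 0.
Proof. by apply/prodf_neq0 => i _; apply: q_nroot. Qed.

Lemma qfactS n : qfact n.+1 = qfact n * (1 - q ^+ n.+1).
Proof. by rewrite /qfact big_ord_recr. Qed.

Lemma qbinsum_eq n a b : (forall k, (k <= n)%N -> a k = b k) ->
  qbinsum n a = qbinsum n b.
Proof. by move=> ab; apply: eq_bigr => k _; rewrite ab// -ltnS. Qed.

Lemma qbinsumD n a b : qbinsum n (fun k => a k + b k) = qbinsum n a + qbinsum n b.
Proof. by rewrite -big_split; apply: eq_bigr => k _; rewrite mulrDl. Qed.

Lemma qbinsumZ n c a : qbinsum n (fun k => c * a k) = c * qbinsum n a.
Proof. by rewrite mulr_sumr; apply: eq_bigr => k _; rewrite mulrA. Qed.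

(** The factor 1 - q^(n+1-k) cancels the last factor of (q)_(n+1-k). *)
Lemma qbinsum_absorbl n a :
  qbinsum n.+1 (fun k => (1 - q ^+ (n.+1 - k)) * a k) = qbinsum n a.
Proof.
rewrite /qbinsum big_ord_recr /= subnn expr0 subrr !mul0r addr0.
apply: eq_bigr => k _; rewrite subSn; last by rewrite -ltnS.
rewrite qfactS; field.
by rewrite !qfact_neq0 q_nroot.
Qed.

Lemma qbinsum_absorbr n a :
  qbinsum n.+1 (fun k => (1 - q ^+ k) * a k) = qbinsum n (fun k => a k.+1).
Proof.
rewrite /qbinsum big_ord_recl /= expr0 subrr !mul0r add0r.
apply: eq_bigr => k _; rewrite /bump /= add1n subSS qfactS; field.
by rewrite !qfact_neq0 q_nroot.
Qed.

(** Write 1 - q^(n+1) = (1 - q^(n+1-k)) + q^(n+1-k) (1 - q^k) and absorb each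
    summand into the weight. *)
Lemma qbinsum_pascall n a : (1 - q ^+ n.+1) * qbinsum n.+1 a
  = qbinsum n (fun k => a k + q ^+ (n - k) * a k.+1).
Proof.
rewrite qbinsumD -(qbinsum_absorbl n a) -qbinsumZ.
rewrite -(qbinsum_absorbr n (fun k => q ^+ (n.+1 - k) * a k)) -qbinsumD.
apply: eq_bigr => k _; congr (_ / _).
have -> : q ^+ n.+1 = q ^+ k * q ^+ (n.+1 - k) by rewrite -exprD subnKC// -ltnS.
by ring.
Qed.

(** The other splitting, 1 - q^(n+1) = (1 - q^k) + q^k (1 - q^(n+1-k)). *)
Lemma qbinsum_pascalr n a : (1 - q ^+ n.+1) * qbinsum n.+1 a
  = qbinsum n (fun k => a k.+1 + q ^+ k * a k).
Proof.
rewrite qbinsumD -(qbinsum_absorbr n a) -qbinsumZ.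
rewrite -(qbinsum_absorbl n (fun k => q ^+ k * a k)) -qbinsumD.
apply: eq_bigr => k _; congr (_ / _).
have -> : q ^+ n.+1 = q ^+ k * q ^+ (n.+1 - k) by rewrite -exprD subnKC// -ltnS.
by ring.
Qed.

Lemma qbinomial n Y :
  qbinsum n (gprod Y) = (\prod_(i < n) (1 + Y * q ^+ i)) / qfact n.
Proof.
elim: n Y => [|n IH] Y.
  by rewrite /qbinsum big_ord1 /gprod /qfact !big_ord0 mulr1.
apply: (mulfI (q_nroot n)); rewrite qbinsum_pascalr.
rewrite (@qbinsum_eq _ _ (fun k => (1 + Y) * gprod (Y * q) k)); last first.
  by move=> k _; rewrite gprodS gprodMq; ring.
rewrite qbinsumZ IH big_ord_recl /= expr0 mulr1 qfactS.
rewrite (eq_bigr (fun i : 'I_n => 1 + Y * q ^+ (bump 0 i))); last first.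
  by move=> i _; rewrite /bump /= add1n exprS mulrA.
by field; rewrite qfact_neq0 q_nroot.
Qed.

(** Partial fractions of Y^r / prod_(i <= n) (1 - Y q^i), with c standing for
    - q^(1-r), so that gprod c k is the numerator of the k-th residue.  The
    fraction is proper for r <= n.  The first recurrence raises n with r fixed and
    so leaves out r = n, where the second one, raising n and r together, applies. *)
Lemma q_partial_fractions n r c Y : (r <= n)%N -> c * q ^+ r = - q ->
  (forall i : nat, 1 - Y * q ^+ i != 0) ->
  qbinsum n (fun k => gprod c k / (1 - Y * q ^+ k))
  = Y ^+ r / \prod_(i < n.+1) (1 - Y * q ^+ i).
Proof.
elim: n r c Y => [|n IH] r c Y rn cE Y0.
  move: rn; rewrite leqn0 => /eqP ->.
  rewrite /qbinsum !big_ord1 /gprod /qfact !big_ord0 !expr0; field.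
  by have := Y0 0%N; rewrite expr0 mulr1 oner_eq0 andbT.
have Yq0 i : 1 - Y * q * q ^+ i != 0 by have := Y0 i.+1; rewrite exprS mulrA.
have Y1 : 1 - Y != 0 by have := Y0 0%N; rewrite expr0 mulr1.
set P := \prod_(i < n) (1 - Y * q ^+ i.+1).
have P0 : P != 0 by apply/prodf_neq0 => i _; apply: Y0.
have P1 : \prod_(i < n.+1) (1 - Y * q ^+ i) = (1 - Y) * P.
  by rewrite big_ord_recl /= expr0 mulr1.
have P2 : \prod_(i < n.+1) (1 - Y * q * q ^+ i) = P * (1 - Y * q ^+ n.+1).
  rewrite big_ord_recr /= exprS mulrA; congr (_ * _).
  by apply: eq_bigr => i _; rewrite exprS mulrA.
have P3 : \prod_(i < n.+2) (1 - Y * q ^+ i) = (1 - Y) * P * (1 - Y * q ^+ n.+1).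
  by rewrite big_ord_recr /= P1.
have Yn := Y0 n.+1.
apply: (mulfI (q_nroot n)); rewrite P3.
have [rn'|] := leqP r n.
  rewrite qbinsum_pascall.
  rewrite (@qbinsum_eq _ _ (fun k => gprod c k / (1 - Y * q ^+ k)
      + (c * q ^+ n) * (gprod c k / (1 - Y * q * q ^+ k)))); last first.
    move=> k kn; rewrite gprodS.
    have -> : q ^+ n = q ^+ (n - k) * q ^+ k by rewrite -exprD subnK.
    rewrite (exprS q k) !mulrA; field.
    by have := Yq0 k; rewrite Y0 => ->.
  rewrite qbinsumD qbinsumZ (IH r) // (IH r)// P1 P2 exprMn.
  have -> : c * q ^+ n * (Y ^+ r * q ^+ r / (P * (1 - Y * q ^+ n.+1))) =
     - q * q ^+ n * (Y ^+ r / (P * (1 - Y * q ^+ n.+1))) by rewrite -cE; ring.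
  rewrite exprS in Yn *.
  by field; rewrite P0 Y1 Yn.
rewrite leq_eqVlt ltnNge rn orbF => /eqP rE.
have cE' : c * q ^+ n = -1.
  by apply: (mulIf q_neq0); rewrite -mulrA -exprSr rE cE mulN1r.
rewrite qbinsum_pascalr.
rewrite (@qbinsum_eq _ _ (fun k => c * (gprod (c * q) k / (1 - Y * q * q ^+ k))
      + gprod (c * q) k / (1 - Y * q ^+ k))); last first.
  move=> k _; rewrite gprodS gprodMq exprS mulrA; field.
  by rewrite Yq0 Y0.
rewrite qbinsumD qbinsumZ (IH n) // ?(IH n)//; try by rewrite mulrAC cE' mulN1r.
rewrite P1 P2 -rE exprMn.
have -> : c * (Y ^+ n * q ^+ n / (P * (1 - Y * q ^+ n.+1))) =
     - (Y ^+ n / (P * (1 - Y * q ^+ n.+1))) by rewrite -[RHS]mulN1r -cE'; ring.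
rewrite (exprS Y).
by field; rewrite P0 Y1 Yn.
Qed.

(** The weight at distance k above, or k + 1 below, the middle of a sum with 2n + 2
    terms; an even number of terms makes the two halves symmetric. *)
Definition qweight (n k : nat) : K := (qfact (n.+1 + k) * qfact (n - k))^-1.

Lemma qbinsum_centred n a : qbinsum (n + n).+1 a
  = \sum_(k < n.+1) qweight n k * (a (n.+1 + k)%N + a (n - k)%N).
Proof.
rewrite /qbinsum -addnS -addSn big_split_ord /=.
rewrite [X in X + _](reindex_inj rev_ord_inj) -big_split /=.
apply: eq_bigr => k _; have kn : (k <= n)%N by rewrite -ltnS.
have -> : (n + n.+1 - (n.+1 - k.+1) = n.+1 + k)%N by lia.
have -> : (n + n.+1 - (n.+1 + k) = n - k)%N by lia.
have -> : (n.+1 - k.+1 = n - k)%N by lia.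
by rewrite /qweight; field; rewrite !qfact_neq0.
Qed.

(** The terms below the middle, read downwards: the k + 1 factors that lead from
    n - k to n + 1 multiply to the inverse of gprod (q / Y) k.+1. *)
Lemma gprod_rev Y n k : (k <= n)%N -> Y != 0 ->
  gprod (Y / q ^+ n.+1) (n - k) = gprod (Y / q ^+ n.+1) n.+1 * gprod (q / Y) k.+1.
Proof.
move=> kn Y0.
have nE : n.+1 = (n - k + k.+1)%N by lia.
rewrite [in RHS]nE gprodD -mulrA -[LHS]mulr1 -nE; congr (_ * _).
rewrite /gprod (reindex_inj rev_ord_inj) -big_split /= big1// => i _.
rewrite subSS; have ik : (i <= k)%N by rewrite -ltnS.
have -> : q ^+ n.+1 = q ^+ (n - k) * q ^+ (k - i) * q ^+ i * q.
  by rewrite -!exprD -exprSr; congr (_ ^+ _); lia.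
by field; rewrite Y0 q_neq0 !expf_neq0.
Qed.

(** The factors with negative exponents: 1 + Y q^-m = Y q^-m (1 + Y^-1 q^m). *)
Lemma prod_centred Y n : Y != 0 ->
  \prod_(i < n.+1) (1 + Y / q ^+ n.+1 * q ^+ i)
  = gprod (Y / q ^+ n.+1) n.+1 * \prod_(i < n.+1) (1 + Y^-1 * q ^+ i.+1).
Proof.
move=> Y0; rewrite [X in _ = _ * X](reindex_inj rev_ord_inj) -big_split /=.
apply: eq_bigr => i _; rewrite subSS.
have ik : (i <= n)%N by rewrite -ltnS.
have -> : q ^+ n.+1 = q ^+ (n - i) * q ^+ i * q.
  by rewrite -!exprD -exprSr; congr (_ ^+ _); lia.
by rewrite exprSr; field; rewrite Y0 q_neq0 !expf_neq0.
Qed.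

Lemma prod_shift Y n m :
  \prod_(i < m) (1 + Y / q ^+ n * q ^+ (n + i)) = \prod_(i < m) (1 + Y * q ^+ i).
Proof.
by apply: eq_bigr => i _; rewrite exprD; congr (_ + _); field; rewrite expf_neq0.
Qed.

Lemma prod_splitD (F : nat -> K) m n :
  \prod_(i < m + n) F i = (\prod_(i < m) F i) * \prod_(i < n) F (m + i)%N.
Proof. exact: big_split_ord. Qed.

(** The q-binomial theorem with 2n + 1 factors, at Y q^-(n+1). *)
Lemma finite_triple_product n Y : Y != 0 ->
  \sum_(k < n.+1) qweight n k * (gprod Y k + gprod (q / Y) k.+1)
  = (\prod_(i < n.+1) (1 + Y^-1 * q ^+ i.+1)) * (\prod_(i < n) (1 + Y * q ^+ i))
    / qfact (n + n).+1.
Proof.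
move=> Y0; have Q0 := @gprod_neq0 (Y / q ^+ n.+1) n.+1.
have {}Q0 : gprod (Y / q ^+ n.+1) n.+1 != 0.
  by apply: Q0; rewrite mulf_neq0// invr_neq0// expf_neq0.
apply: (mulfI Q0); rewrite mulr_sumr.
have := qbinomial (n + n).+1 (Y / q ^+ n.+1).
have -> := prod_splitD (fun i => 1 + Y / q ^+ n.+1 * q ^+ i) n.+1 n.
rewrite qbinsum_centred prod_shift prod_centred// -!mulrA => <-.
apply: eq_bigr => k _; rewrite gprodD gprod_rev //; last by rewrite -ltnS.
rewrite -(mulrA Y) mulVf ?expf_neq0// mulr1; ring.
Qed.

(** The partial fractions with 2n + 2 factors, at Y = - X q^-(n+1) and r = n + 1.
    This exponent makes the powers of q in the terms symmetric about the middle. *)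
Lemma finite_reciprocal_product n X : X != 0 ->
  (forall i : nat, 1 + X * q ^+ i != 0) ->
  (forall i : nat, 1 + X / q ^+ i.+1 != 0) ->
  \sum_(k < n.+1) qweight n k *
     (gprod (- q) k / (1 + X * q ^+ k) - gprod (- q) k / (1 + X / q ^+ k.+1))
  = ((\prod_(i < n.+1) (1 + X^-1 * q ^+ i.+1)) * (\prod_(i < n.+1) (1 + X * q ^+ i)))^-1.
Proof.
move=> X0 Xp Xn.
set c := - q / q ^+ n.+1; set Y := - (X / q ^+ n.+1).
have c0 : c != 0 by rewrite mulf_neq0 ?oppr_eq0// invr_neq0// expf_neq0.
have Q0 : gprod c n.+1 != 0 by apply: gprod_neq0.
have YE i : 1 - Y * q ^+ i = 1 + X / q ^+ n.+1 * q ^+ i by rewrite /Y; ring.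
have Yhi i : 1 + X / q ^+ n.+1 * q ^+ (n.+1 + i) = 1 + X * q ^+ i.
  by rewrite exprD; congr (_ + _); field; rewrite expf_neq0.
have Ylo i : (i <= n)%N ->
    1 + X / q ^+ n.+1 * q ^+ (n - i) = 1 + X / q ^+ i.+1.
  move=> ik; have -> : q ^+ n.+1 = q ^+ (n - i) * q ^+ i.+1.
    by rewrite -!exprD; congr (_ ^+ _); lia.
  by congr (_ + _); field; rewrite !expf_neq0.
have Y0 i : 1 - Y * q ^+ i != 0.
  rewrite YE; have [ni|ni] := leqP n.+1 i.
    by rewrite -(subnKC ni) Yhi.
  have -> : i = (n - (n - i))%N by lia.
  by rewrite Ylo// leq_subr.
have cE : c * q ^+ n.+1 = - q by rewrite mulfVK// expf_neq0.
have rn : (n.+1 <= (n + n).+1)%N by lia.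
have := q_partial_fractions rn cE Y0.
rewrite qbinsum_centred => H.
apply: (mulfI Q0); rewrite mulr_sumr.
rewrite (eq_bigr (fun k : 'I_n.+1 => qweight n k *
  (gprod c (n.+1 + k) / (1 - Y * q ^+ (n.+1 + k)) +
   gprod c (n - k) / (1 - Y * q ^+ (n - k))))); last first.
  move=> k _; have kn : (k <= n)%N by rewrite -ltnS.
  rewrite gprodD cE !YE Yhi Ylo// gprod_rev ?oppr_eq0//.
  have -> : gprod (q / - q) k.+1 = - gprod (- q) k.
    rewrite invrN mulrN divff// /gprod big_ord_recl /= expr0 mulr1 mulN1r; congr (- _).
    by apply: eq_bigr => i _; rewrite /bump /= add1n exprS mulN1r mulNr.
  by rewrite -[gprod (- q / _) _]/(gprod c n.+1); ring.
rewrite H (_ : (n + n).+2 = n.+1 + n.+1)%N; last by lia.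
have -> := prod_splitD (fun i => 1 - Y * q ^+ i) n.+1 n.+1.
rewrite (eq_bigr (fun i : 'I_n.+1 => 1 + X / q ^+ n.+1 * q ^+ i));
  last by move=> i _; exact: YE.
rewrite prod_centred //.
rewrite [X in Y ^+ _ / (_ * X)](eq_bigr (fun i : 'I_n.+1 => 1 + X * q ^+ i)); last first.
  by move=> i _; rewrite YE Yhi.
have -> : Y ^+ n.+1 = gprod c n.+1 * gprod (X / q ^+ n.+1) n.+1.
  transitivity (\prod_(i < n.+1) Y); first by rewrite prodr_const card_ord.
  rewrite /gprod [X in _ = X * _](reindex_inj rev_ord_inj) -big_split /=.
  apply: eq_bigr => i _.
  have ik : (i <= n)%N by rewrite -ltnS.
  rewrite subSS /c /Y.
  have -> : q ^+ n.+1 = q ^+ (n - i) * q ^+ i * q.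
    by rewrite -!exprD -exprSr; congr (_ ^+ _); lia.
  by field; rewrite q_neq0 !expf_neq0.
have G0 : gprod (X / q ^+ n.+1) n.+1 != 0.
  by apply: gprod_neq0; rewrite mulf_neq0// invr_neq0// expf_neq0.
set A := \prod_(i < n.+1) (1 + X^-1 * _); set B := \prod_(i < n.+1) _.
have B0 : B != 0 by apply/prodf_neq0 => i _.
have A0 : A != 0.
  apply/prodf_neq0 => i _; have := Xn i; apply: contraNN => /eqP A0.
  have -> : 1 + X / q ^+ i.+1 = X / q ^+ i.+1 * (1 + X^-1 * q ^+ i.+1).
    by field; rewrite X0 expf_neq0.
  by rewrite A0 mulr0.
by field; rewrite A0 B0 G0.
Qed.

End FiniteIdentities.

(** * The complex exponential *)

Section ExpC.
Variable R : realType.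
Implicit Types (x y : R[i]).

Lemma cexpD x y : cexp (x + y) = cexp x * cexp y.
Proof.
case: x => a b; case: y => c d; rewrite /cexp /= expRD cosD sinD; simpc.
by congr (_ +i* _); ring.
Qed.

Lemma cexp0 : cexp 0 = 1 :> R[i].
Proof. by rewrite /cexp /= expR0 cos0 sin0; simpc. Qed.

Lemma cexpN x : cexp (- x) = (cexp x)^-1.
Proof.
have h : cexp (- x) * cexp x = 1 by rewrite -cexpD addNr cexp0.
have x0 : cexp x != 0 by apply: contra_eq_neq h => ->; rewrite mulr0 eq_sym oner_eq0.
by apply: (mulIf x0); rewrite h mulVf.
Qed.

Lemma cexp_neq0 x : cexp x != 0.
Proof.
apply/eqP => h; have : cexp (x - x) = 0 by rewrite cexpD h mul0r.
by rewrite subrr cexp0 => /eqP; rewrite oner_eq0.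
Qed.

Lemma cexpMn n x : cexp (n%:R * x) = cexp x ^+ n.
Proof.
elim: n => [|n IH]; first by rewrite mul0r cexp0 expr0.
by rewrite -natr1 mulrDl mul1r cexpD IH exprSr.
Qed.

Lemma normc_cexp x : normc (cexp x) = expR (complex.Re x).
Proof.
rewrite /cexp /= !exprMn -mulrDr cos2Dsin2 mulr1 sqrtr_sqr ger0_norm// expR_ge0.
Qed.

Lemma ReD x y : complex.Re (x + y) = complex.Re x + complex.Re y.
Proof. by case: x; case: y. Qed.

Lemma tpi_neq0 : tpi R != 0.
Proof.
rewrite /tpi /piC mulf_neq0//; last by rewrite eq_complex /= oner_eq0 andbF.
by rewrite mulf_neq0 ?pnatr_eq0// (eq_complex _ 0) /= eqxx andbT gt_eqF// pi_gt0.
Qed.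

Lemma tpiE (a b : R) : tpi R * (a +i* b) = (- (pi *+ 2 * b)) +i* (pi *+ 2 * a).
Proof.
have -> : tpi R = 0 +i* (pi *+ 2).
  by rewrite /tpi /piC -[2]/(1 + 1); simpc; rewrite mulr2n mulrDl mul1r; simpc.
by simpc.
Qed.

Lemma cexp_half : cexp (tpi R / 2) = -1.
Proof.
have -> : tpi R / 2 = 0 +i* pi.
  rewrite /tpi mulrAC [2 * _]mulrC mulfK ?pnatr_eq0// /piC; by simpc.
by rewrite /cexp /= expR0 cospi sinpi; simpc.
Qed.

Lemma cexp_tpi : cexp (tpi R) = 1.
Proof.
have -> : tpi R = tpi R / 2 + tpi R / 2 by field.
by rewrite cexpD cexp_half mulrNN mulr1.
Qed.

Lemma cexp_tpi_int (n : int) : cexp (tpi R * n%:~R) = 1.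
Proof.
have nat_case k : cexp (tpi R * k%:R) = 1 by rewrite mulrC cexpMn cexp_tpi expr1n.
case: n => k; first exact: nat_case.
by rewrite NegzE mulrNz mulrN cexpN (nat_case k.+1) invr1.
Qed.

(** The integer is the integral part of the real part of x: subtracting it leaves
    some a in [0, 1) with 1 = cos (2 pi a) = 1 - 2 sin^2 (pi a), and sin is
    positive on (0, pi). *)
Lemma cexp_eq1 x : cexp (tpi R * x) = 1 -> exists a : int, x = a%:~R.
Proof.
move=> h; exists (Num.floor (complex.Re x)).
set n := Num.floor _.
have {}h : cexp (tpi R * (x - n%:~R)) = 1.
  by rewrite mulrBr cexpD h cexpN cexp_tpi_int invr1 mulr1.
apply/eqP; rewrite -subr_eq0; move: h.
have : 0 <= complex.Re (x - n%:~R) < 1.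
  rewrite -(rmorph_int (@real_complex R)) -rmorphN ReD /=.
  by rewrite subr_ge0 floor_le ltrBlDl -intrD1 floorD1_gt.
case: (x - _) => {x n} a b /= /andP[a0 a1]; rewrite tpiE => h.
have b0 : b = 0.
  have := congr1 normc h; rewrite normc_cexp normc1 /= => /eqP.
  rewrite -expR0 (inj_eq (@expR_inj R)) oppr_eq0 mulf_eq0 => /orP[|/eqP//].
  by rewrite mulrn_eq0/= gt_eqF// pi_gt0.
move: h; rewrite b0 mulr0 oppr0 /cexp /= expR0 !mul1r => -[+ _].
have -> : pi *+ 2 * a = (pi * a) *+ 2 by rewrite mulrnAl.
rewrite cos_mulr2n cos2sin2 => h.
have : sin (pi * a) = 0.
  by apply/eqP; rewrite -sqrf_eq0; apply/eqP; lra.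
have [->|a_neq0] := eqVneq a 0; first by [].
have a_gt0 : 0 < a by rewrite lt_neqAle eq_sym a_neq0.
have : 0 < sin (pi * a).
  by apply: sin_gt0_pi; rewrite mulr_gt0 ?pi_gt0//= -[ltRHS]mulr1 ltr_pM2l ?pi_gt0.
by move=> + s0; rewrite s0 ltxx.
Qed.

End ExpC.

(** * Bilateral series *)

Section BilateralSums.
Local Open Scope classical_set_scope.
Local Open Scope ring_scope.
Variable R : realType.
Local Notation C := (R[i] : numFieldType).
Implicit Types (f g : int -> C).

(** The exponent is the absolute value of the index, so that the property passes
    to any reindexing that does not bring indices closer to 0. *)
Definition geom_domZ f :=
  exists A r : R, [/\ 0 <= r, r < 1 & forall n : int, normc (f n) <= A * r ^+ `|n|%N].

Lemma geom_domZ_ge0 f : geom_domZ f -> exists A r : R,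
  [/\ 0 <= A, 0 <= r, r < 1 & forall n : int, normc (f n) <= A * r ^+ `|n|%N].
Proof.
case=> A [r [r0 r1 h]]; exists A, r; split=> //.
by have := h 0; rewrite absz0 expr0 mulr1; apply: le_trans; apply: normc_ge0.
Qed.

Lemma geom_domZ_sub f (phi : int -> int) : geom_domZ f ->
  (forall n, `|n| <= `|phi n|)%N -> geom_domZ (fun n => f (phi n)).
Proof.
move=> /geom_domZ_ge0[A [r [A0 r0 r1 h]]] hphi; exists A, r; split=> // n.
apply: le_trans (h _) _; rewrite ler_wpM2l// ler_wiXn2l// ?ltW//.
Qed.

Lemma geom_domZ_Posz f : geom_domZ f -> geom_dom (fun n => f (Posz n)).
Proof. by case=> A [r [r0 r1 h]]; exists A, r; split=> // n; apply: h. Qed.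

Lemma geom_domZ_Negz f : geom_domZ f -> geom_dom (fun n => f (Negz n)).
Proof.
move=> /geom_domZ_ge0[A [r [A0 r0 r1 h]]]; exists A, r; split=> // n.
apply: le_trans (h _) _; rewrite ler_wpM2l// ler_wiXn2l// ?ltW//.
Qed.

Lemma geom_domZ_halves f : geom_dom (fun n => f (Posz n)) ->
  geom_dom (fun n => f (Negz n)) -> geom_domZ f.
Proof.
move=> /geom_dom_ge0[A [r [A0 r0 r1 hp]]] /geom_dom_ge0[B [s [B0 s0 s1 hn]]].
pose c : R := Num.max (Num.max r s) 2^-1.
have c0 : 0 < c by rewrite lt_max invr_gt0 ltr0n orbT.
have rc : r <= c by rewrite !le_max lexx.
have sc : s <= c by rewrite !le_max lexx orbT.
have c1 : c <= 1 by rewrite !ge_max ltW// ltW//= invf_le1 ?ler1n.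
exists ((A + B) / c), c; split=> [||n]; first exact: ltW.
  by rewrite !gt_max r1 s1 invf_lt1 ?ltr1n.
case: n => n /=.
  apply: le_trans (hp n) _; apply: ler_pM; rewrite ?exprn_ge0//.
    by rewrite ler_pdivlMr// (le_trans (ler_piMr _ _) _)// lerDl.
  by rewrite lerXn2r ?nnegrE ?(ltW c0).
rewrite exprS mulrA divfK ?gt_eqF//.
apply: le_trans (hn n) _; apply: ler_pM; rewrite ?exprn_ge0 ?lerDr//.
by rewrite lerXn2r ?nnegrE ?(ltW c0).
Qed.

Lemma geom_dom_cvg (u : nat -> C) : geom_dom u ->
  series u @ \oo --> limn (series u).
Proof. exact: geom_dom_series. Qed.

Lemma lim_hausC (u : nat -> C) (l : C) : u @ \oo --> l -> limn u = l.
Proof. exact: (cvg_lim (@norm_hausdorff _ C)). Qed.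

Lemma sumZ_halves f (a b : C) : series (fun n => f (Posz n)) @ \oo --> a ->
  series (fun n => f (Negz n)) @ \oo --> b -> sumZ f = a + b.
Proof. by move=> /lim_hausC <- /lim_hausC <-. Qed.

(** Pairing n with -1 - n turns a bilateral series into a series over the natural
    numbers, which is how the centred finite sums approximate it. *)
Lemma sumZ_pair f : geom_dom (fun n => f (Posz n)) -> geom_dom (fun n => f (Negz n)) ->
  sumZ f = limn (series (fun n => f (Posz n) + f (Negz n))).
Proof.
move=> /geom_dom_cvg h1 /geom_dom_cvg h2; rewrite (sumZ_halves h1 h2).
apply/esym/lim_hausC.
have h := cvgD h1 h2.
rewrite (_ : series (fun n => _) = series (fun n => f (Posz n)) + series (fun n => f (Negz n)));
  first exact: h.
by apply/funext => n; rewrite /series /= big_split.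
Qed.

Lemma sumZ_linear f g (a b : C) : geom_domZ f -> geom_domZ g ->
  sumZ (fun n => a * f n + b * g n) = a * sumZ f + b * sumZ g.
Proof.
move=> hf hg.
have half (u v : nat -> C) : geom_dom u -> geom_dom v ->
    series (fun n => a * u n + b * v n) @ \oo --> a * limn (series u) + b * limn (series v).
  move=> /geom_dom_cvg hu /geom_dom_cvg hv.
  have h := cvgD (cvgM (@cvg_cst C a _ \oo _) hu) (cvgM (@cvg_cst C b _ \oo _) hv).
  rewrite (_ : series _ = cst a \* series u + cst b \* series v); first exact: h.
  by apply/funext => n; rewrite /series /= big_split /= -!mulr_sumr.
rewrite (sumZ_halves (half _ _ (geom_domZ_Posz hf) (geom_domZ_Posz hg))
  (half _ _ (geom_domZ_Negz hf) (geom_domZ_Negz hg))).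
rewrite (sumZ_halves (geom_dom_cvg (geom_domZ_Posz hf)) (geom_dom_cvg (geom_domZ_Negz hf))).
rewrite (sumZ_halves (geom_dom_cvg (geom_domZ_Posz hg)) (geom_dom_cvg (geom_domZ_Negz hg))).
by ring.
Qed.

Lemma eq_sumZ f g : f =1 g -> sumZ f = sumZ g.
Proof. by move=> /funext ->. Qed.

Lemma sumZZ (c : C) f : geom_domZ f -> sumZ (fun n => c * f n) = c * sumZ f.
Proof.
move=> hf; have := sumZ_linear c 0 hf hf; rewrite mul0r addr0 => <-.
by apply: eq_sumZ => n; rewrite mul0r addr0.
Qed.

Lemma sumZN f : geom_domZ f -> sumZ (fun n => - f n) = - sumZ f.
Proof.
move=> hf; rewrite -mulN1r -sumZZ//.
by apply: eq_sumZ => n; rewrite mulN1r.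
Qed.

(** The involution n |-> -1 - n exchanges the two halves of a bilateral series. *)
Lemma sumZ_swap f : sumZ (fun n => f (-1 - n)) = sumZ f.
Proof.
rewrite /sumZ addrC; congr (limn _ + limn _); apply/funext => N;
  apply: eq_bigr => k _; congr f; lia.
Qed.

(** Negation exchanges the halves up to the term of index 0. *)
Lemma sumZ_opp f : geom_domZ f -> sumZ (fun n => f (- n)) = sumZ f.
Proof.
move=> hf.
have h1 := geom_dom_cvg (geom_domZ_Posz hf).
have h2 := geom_dom_cvg (geom_domZ_Negz hf).
rewrite (sumZ_halves h1 h2).
set a := limn _ in h1 *; set b := limn _ in h2 *.
rewrite (@sumZ_halves _ (f 0 + b) (- f 0 + a)); first by ring.
  rewrite -cvg_shiftS.
  have h := cvgD (@cvg_cst C (f 0) _ \oo _) h2.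
  rewrite (_ : [sequence _]_n = cst (f 0) + series (fun n => f (Negz n))); first exact: h.
  apply/funext => n; rewrite /series /= big_nat_recl// oppr0; congr (_ + _).
rewrite -cvg_shiftS in h1.
have h := cvgD (@cvg_cst C (- f 0) _ \oo _) h1.
rewrite (_ : series _ = cst (- f 0) + [sequence series (fun n : nat => f n) n.+1]_n);
  first exact: h.
apply/funext => n; rewrite /series [RHS]/GRing.add /= big_nat_recl// addKr.
by apply: eq_bigr => k _.
Qed.

(** On each half, the partial sums of even length 2N of f are the sums of the N-th
    partial sums of its even and odd parts. *)
Lemma sumZ_parity f : geom_domZ f ->
  sumZ (fun n => f (2 * n)) + sumZ (fun n => f (2 * n + 1)) = sumZ f.
Proof.
move=> hf.
have he : geom_domZ (fun n => f (2 * n)) by apply: geom_domZ_sub => // n; lia.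
have ho : geom_domZ (fun n => f (2 * n + 1)) by apply: geom_domZ_sub => // n; lia.
rewrite (sumZ_halves (geom_dom_cvg (geom_domZ_Posz hf)) (geom_dom_cvg (geom_domZ_Negz hf))).
rewrite (sumZ_halves (geom_dom_cvg (geom_domZ_Posz he)) (geom_dom_cvg (geom_domZ_Negz he))).
rewrite (sumZ_halves (geom_dom_cvg (geom_domZ_Posz ho)) (geom_dom_cvg (geom_domZ_Negz ho))).
have split2 (u v w : nat -> C) : geom_dom u -> geom_dom v -> geom_dom w ->
   (forall n, v n = u n.*2) -> (forall n, w n = u n.*2.+1) ->
   limn (series u) = limn (series v) + limn (series w).
  move=> hu hv hw vE wE.
  have /(_ _) h := cvgD (geom_dom_cvg hv) (geom_dom_cvg hw).
  have hd : double @ \oo --> \oo.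
    by move=> P [n _ Pn]; exists n => // m /= nm; apply: Pn; rewrite /= -addnn; lia.
  have h' := cvg_comp _ _ hd (geom_dom_cvg hu).
  rewrite -(lim_hausC h') -(lim_hausC h); congr (lim (_ @ \oo)); apply/funext => n /=.
  rewrite [RHS]/GRing.add /= /series /= -big_split /=.
  elim: n => [|n IH]; first by rewrite !big_geq.
  by rewrite doubleS !big_nat_recr//= IH vE wE addrA.
rewrite (split2 _ _ _ (geom_domZ_Posz hf) (geom_domZ_Posz he) (geom_domZ_Posz ho)).
- rewrite (split2 _ _ _ (geom_domZ_Negz hf) (geom_domZ_Negz ho) (geom_domZ_Negz he)).
  + by ring.
  + by move=> n; congr f; lia.
  + by move=> n; congr f; lia.
- by move=> n; congr f; lia.
- by move=> n; congr f; lia.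
Qed.

End BilateralSums.

(** * The triple product and the reciprocal product in the limit *)

Section InfiniteProducts.
Local Open Scope classical_set_scope.
Local Open Scope ring_scope.
Variable R : realType.
Local Notation C := (R[i] : numFieldType).
Variable q : C.
Hypothesis q_neq0 : q != 0.
Hypothesis q_lt1 : normc q < 1.

Lemma q_nroot (i : nat) : 1 - q ^+ i.+1 != 0.
Proof.
rewrite subr_eq0; apply/eqP => /(congr1 normc); rewrite normc1 normcX => h.
have : normc q ^+ i.+1 < 1 by rewrite exprn_ilt1 ?normc_ge0.
by rewrite -h ltxx.
Qed.

Lemma geom_dom_powers (a : C) : geom_dom (fun n => a * q ^+ n).
Proof.
exists (normc a), (normc q); split=> // [|n]; first exact: normc_ge0.
by rewrite normcM normcX.
Qed.

(** Gaussian decay beats any geometric growth: 2^n gprod q a n = gprod q (2 a) n is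
    bounded by a convergent product, so gprod q a n is O(2^-n). *)
Lemma geom_dom_gprod (a : C) : geom_dom (gprod q a).
Proof.
(* The factors 1 + u k dominate the factors of gprod q (2 a). *)
pose u n : C := (normc (2 * a) * normc q ^+ n)%:C.
have hu : geom_dom u.
  exists (normc (2 * a)), (normc q); split=> // [|n]; first exact: normc_ge0.
  by rewrite /= expr0n/= addr0 sqrtr_sqr ger0_norm// mulr_ge0 ?exprn_ge0 ?normc_ge0.
have /cvg_ex[l /cvg_bounded_seq[B hB]] := geom_dom_prod hu.
exists B, 2^-1; split=> [||n]; [lra|lra|].
have n2 : normc (2 : R[i]) = 2.
  by have := norm_normc (2 : R[i]); rewrite normr_nat => -[].
have -> : gprod q a n = gprod q (2 * a) n * 2^-1 ^+ n.
  elim: n => [|n IH]; first by rewrite /gprod !big_ord0 mulr1.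
  by rewrite !gprodS IH !exprS; field; rewrite ?pnatr_eq0 ?expf_neq0 ?pnatr_eq0.
rewrite normcM normcX normcV n2 ler_wpM2r ?exprn_ge0 ?invr_ge0//.
apply: le_trans (hB n); rewrite /gprod !normc_prod; apply: ler_prod => k _.
apply/andP; split; first exact: normc_ge0.
have -> : 1 + u k = (1 + normc (2 * a) * normc q ^+ k)%:C by rewrite rmorphD.
rewrite normcM normcX /= expr0n/= addr0 sqrtr_sqr ger0_norm ?lerDr//.
by rewrite addr_ge0// mulr_ge0 ?exprn_ge0 ?normc_ge0.
Qed.

(** The Euler product (q;q) with infinitely many factors. *)
Definition qfact_oo : C := limn (qfact q).

Lemma qfact_prod : qfact q = (fun n => \prod_(k < n) (1 + - q * q ^+ k) : C).
Proof.
by apply/funext => n; apply: eq_bigr => i _; rewrite mulNr exprS.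
Qed.

Lemma qfact_cvg : qfact q @ \oo --> qfact_oo.
Proof. by rewrite /qfact_oo qfact_prod; exact: (geom_dom_prod (geom_dom_powers (- q))). Qed.

Lemma qfact_oo_neq0 : qfact_oo != 0.
Proof.
rewrite /qfact_oo qfact_prod.
apply: (geom_dom_prod_neq0 (geom_dom_powers (- q))) => k.
by rewrite mulNr -exprS; apply: q_nroot.
Qed.

Lemma qweight_cvg k : (fun n => qweight q n k) @ \oo --> (qfact_oo ^+ 2)^-1.
Proof.
have h1 : (fun n => qfact q (n.+1 + k)) @ \oo --> qfact_oo.
  under eq_fun do rewrite addSnnS.
  by apply: (cvg_comp (fun n => n + k.+1)%N (qfact q) _ qfact_cvg); exact: cvg_addnr.
have h2 : (fun n => qfact q (n - k)) @ \oo --> qfact_oo.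
  by apply: (cvg_comp (fun n => n - k)%N (qfact q) _ qfact_cvg); exact: cvg_subnr.
have /(_ _) h := cvgM h1 h2.
have e2 : qfact_oo * qfact_oo != 0 by rewrite mulf_neq0 ?qfact_oo_neq0.
exact: (cvgV e2 h).
Qed.

Lemma qweight_bounded : exists B : R, forall n k, normc (qweight q n k) <= B.
Proof.
have /(_ _) hV := cvgV qfact_oo_neq0 qfact_cvg.
have [B B0 hB] := bounded_seq_ge0 (cvg_bounded_seq hV).
exists (B * B) => n k; rewrite /qweight invfM normcM.
by apply: ler_pM; rewrite ?normc_ge0 ?hB.
Qed.

(** The common limit of the centred finite identities, with (q)_(n+1+k) and
    (q)_(n-k) both tending to (q;q). *)
Lemma centred_sum_cvg (b : nat -> C) : geom_dom b ->
  (fun n => \sum_(k < n.+1) qweight q n k * b k : C) @ \oo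
    --> (qfact_oo ^+ 2)^-1 * limn (series b).
Proof.
move=> hb; have [B hB] := qweight_bounded.
(* The n-th weight is shifted by one, since the n-th finite identity has n + 1 terms. *)
have h := @dominated_series _ (fun n k => qweight q n.-1 k) (qfact_oo ^+ 2)^-1 b B hb
  (fun n k => hB n.-1 k).
have /h : forall k, (fun n => qweight q n.-1 k) @ \oo --> (qfact_oo ^+ 2)^-1.
  by move=> k; rewrite -cvg_shiftS; exact: qweight_cvg.
rewrite -cvg_shiftS.
rewrite (_ : [sequence _]_n = (fun n => \sum_(k < n.+1) qweight q n k * b k : C)) //.
by apply/funext => n /=; rewrite big_mkord.
Qed.

(** The q-Pochhammer symbol (-a;q) with infinitely many factors. *)
Definition qpoch_oo (a : C) : C := limn (fun n => \prod_(k < n) (1 + a * q ^+ k) : C).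

Lemma qpoch_oo_cvg a : (fun n => \prod_(k < n) (1 + a * q ^+ k) : C) @ \oo --> qpoch_oo a.
Proof. exact: (geom_dom_prod (geom_dom_powers a)). Qed.

Lemma qpoch_oo_neq0 a : (forall k : nat, 1 + a * q ^+ k != 0) -> qpoch_oo a != 0.
Proof. exact: (geom_dom_prod_neq0 (geom_dom_powers a)). Qed.

Lemma qpoch_oo_cvg_inv a : (fun n => \prod_(k < n) (1 + a^-1 * q ^+ k.+1) : C) @ \oo
  --> qpoch_oo (q / a).
Proof.
rewrite (_ : (fun n => _) = (fun n => \prod_(k < n) (1 + q / a * q ^+ k) : C)).
  exact: qpoch_oo_cvg.
by apply/funext => n; apply: eq_bigr => i _; rewrite exprS; congr (_ + _); ring.
Qed.

Lemma geom_dom_gprodS (a : C) : geom_dom (fun k => gprod q a k.+1).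
Proof.
have -> : (fun k => gprod q a k.+1) = (fun k => a * gprod q (a * q) k).
  apply/funext => k; rewrite -add1n gprodD expr1; congr (_ * _).
  by rewrite /gprod big_ord1 mulr1.
apply: (@geom_domM _ (fun=> a)); last exact: geom_dom_gprod.
by exists (normc a).
Qed.

Lemma bounded_inv_factor (X : C) : (forall k : nat, 1 + X * q ^+ k != 0) ->
  bounded_seq (fun k => (1 + X * q ^+ k)^-1).
Proof. by move=> hX; apply: geom_dom_inv => //; exact: geom_dom_powers. Qed.

(** For growing k the denominator tends to infinity; the reflection
    1/(1 + u) = 1 - 1/(1 + 1/u) brings it back to a factor that tends to 1. *)
Lemma bounded_inv_factorN (X : C) : X != 0 -> (forall k : nat, 1 + X / q ^+ k.+1 != 0) ->
  bounded_seq (fun k => (1 + X / q ^+ k.+1)^-1).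
Proof.
move=> X0 hX.
have E k : 1 + X / q ^+ k.+1 = X / q ^+ k.+1 * (1 + q / X * q ^+ k).
  by rewrite exprS; field; rewrite X0 q_neq0 expf_neq0.
have Xi k : 1 + q / X * q ^+ k != 0.
  by have := hX k; rewrite E; apply: contraNN => /eqP ->; rewrite mulr0.
have [B hB] := bounded_inv_factor Xi.
exists (1 + B) => k.
have -> : (1 + X / q ^+ k.+1)^-1 = 1 - (1 + q / X * q ^+ k)^-1.
  have qk : q ^+ k != 0 by rewrite expf_neq0.
  have h1 := hX k; have h2 := Xi k.
  have {}h1 : q ^+ k.+1 + X != 0.
    apply: contraNN h1 => /eqP h; have -> : 1 + X / q ^+ k.+1 = (q ^+ k.+1 + X) / q ^+ k.+1.
      by field; rewrite expf_neq0.
    by rewrite h mul0r.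
  rewrite exprS in h1 *.
  by field; rewrite ?qk ?q_neq0 ?X0 ?h1 ?andbT//= addrC h1.
by apply: le_trans (normcD_le _ _) _; rewrite normcN normc1 lerD2l.
Qed.

(** The limit of [finite_triple_product].  The two summands of the k-th term are
    the terms of index k and -1 - k of the bilateral series. *)
Lemma jacobi_triple_product (X : C) : X != 0 ->
  limn (series (fun k => gprod q X k + gprod q (q / X) k.+1))
  = qfact_oo * (qpoch_oo X * qpoch_oo (q / X)).
Proof.
move=> X0.
have dom : geom_dom (fun k => gprod q X k + gprod q (q / X) k.+1).
  by apply: geom_domD; [exact: geom_dom_gprod|exact: geom_dom_gprodS].
have h := centred_sum_cvg dom.
have h1 := @qpoch_oo_cvg X.
have h2 : (fun n => \prod_(k < n.+1) (1 + X^-1 * q ^+ k.+1) : C) @ \oo --> qpoch_oo (q / X).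
  by have := @qpoch_oo_cvg_inv X; rewrite -cvg_shiftS.
have h3 : (fun n => qfact q (n + n).+1) @ \oo --> qfact_oo.
  apply: (cvg_comp (fun n => (n + n).+1)%N (qfact q) _ qfact_cvg).
  by move=> P [n _ Pn]; exists n => // m /= nm; apply: Pn; rewrite /=; lia.
have /(_ _) h21 := cvgM h2 h1.
have /(_ _) h3V := cvgV qfact_oo_neq0 h3.
have /(_ _) h4 := cvgM h21 h3V.
rewrite (_ : (fun n => _) = (fun n => (\prod_(k < n.+1) (1 + X^-1 * q ^+ k.+1))
   * (\prod_(k < n) (1 + X * q ^+ k)) / qfact q (n + n).+1 : C)) in h; last first.
  by apply/funext => n; apply: finite_triple_product => //; exact: q_nroot.
have := cvg_unique (@norm_hausdorff _ C) h h4.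
have e0 := qfact_oo_neq0.
have -> : qfact_oo * (qpoch_oo X * qpoch_oo (q / X))
  = qfact_oo ^+ 2 * (qpoch_oo (q / X) * qpoch_oo X / qfact_oo) by field.
by move=> <-; field.
Qed.

(** The limit of [finite_reciprocal_product]. *)
Lemma reciprocal_product (X : C) : X != 0 ->
  (forall k : nat, 1 + X * q ^+ k != 0) -> (forall k : nat, 1 + X / q ^+ k.+1 != 0) ->
  limn (series (fun k => gprod q (- q) k / (1 + X * q ^+ k)
                         - gprod q (- q) k / (1 + X / q ^+ k.+1)))
  = qfact_oo ^+ 2 / (qpoch_oo X * qpoch_oo (q / X)).
Proof.
move=> X0 Xp Xn.
have dom : geom_dom (fun k => gprod q (- q) k / (1 + X * q ^+ k)
                         - gprod q (- q) k / (1 + X / q ^+ k.+1)).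
  rewrite (_ : (fun k => _) = (fun k => (1 + X * q ^+ k)^-1 * gprod q (- q) k
       + (-1) * (1 + X / q ^+ k.+1)^-1 * gprod q (- q) k)); last first.
    by apply/funext => k; ring.
  apply: geom_domD; apply: geom_domM; try exact: geom_dom_gprod.
    exact: bounded_inv_factor.
  have [B hB] := bounded_inv_factorN X0 Xn.
  by exists B => k; rewrite mulN1r normcN.
have Xi k : 1 + q / X * q ^+ k != 0.
  have := Xn k; apply: contraNN => /eqP A0.
  have -> : 1 + X / q ^+ k.+1 = X / q ^+ k.+1 * (1 + q / X * q ^+ k).
    by rewrite exprS; field; rewrite X0 q_neq0 expf_neq0.
  by rewrite A0 mulr0.
have h := centred_sum_cvg dom.
have h1 : (fun n => \prod_(k < n.+1) (1 + X * q ^+ k) : C) @ \oo --> qpoch_oo X.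
  by have := @qpoch_oo_cvg X; rewrite -cvg_shiftS.
have h2 : (fun n => \prod_(k < n.+1) (1 + X^-1 * q ^+ k.+1) : C) @ \oo --> qpoch_oo (q / X).
  by have := @qpoch_oo_cvg_inv X; rewrite -cvg_shiftS.
have p1 := qpoch_oo_neq0 Xp; have p2 := qpoch_oo_neq0 Xi.
have p12 : qpoch_oo (q / X) * qpoch_oo X != 0 by rewrite mulf_neq0.
have /(_ _) h21 := cvgM h2 h1.
have /(_ _) h4 := cvgV p12 h21.
rewrite (_ : (fun n => _) = (fun n => ((\prod_(k < n.+1) (1 + X^-1 * q ^+ k.+1))
   * (\prod_(k < n.+1) (1 + X * q ^+ k)))^-1 : C)) in h; last first.
  by apply/funext => n; apply: finite_reciprocal_product => //; exact: q_nroot.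
have := cvg_unique (@norm_hausdorff _ C) h h4.
have e0 := qfact_oo_neq0.
have -> : qfact_oo ^+ 2 / (qpoch_oo X * qpoch_oo (q / X))
  = qfact_oo ^+ 2 * (qpoch_oo (q / X) * qpoch_oo X)^-1.
  by rewrite (mulrC (qpoch_oo X)).
by move=> <-; field.
Qed.

End InfiniteProducts.

(** * The Cartan subalgebra in coordinates *)

Section Cartan.
Variable R : realType.
Local Notation C := R[i].
Implicit Types tau z T : C.

Definition cartan_point tau (z1 z2 T : C) : 'rV[C]_4 := hpoint tau (zvec z1 z2) T.

Ltac cartan_coords :=
  rewrite ?/expf ?/transl ?/refl_theta ?/refl_alpha2;
  do 6? [progress rewrite ?/bform ?/hpoint ?/zvec ?/theta_root ?/Lambda0 ?/alpha3
     ?/alpha1 ?/alpha2 ?/delta ?mxE /=].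

(** The coordinates in the basis (Lambda0, alpha1, alpha2, delta). *)
Lemma cartan_pointE tau z1 z2 T : cartan_point tau z1 z2 T =
  \row_(i < 4) (tpi R * [:: - tau; z2 - z1; - z1; T]`_i).
Proof.
apply/rowP => -[[|[|[|[|//]]]] ?]; rewrite /cartan_point; cartan_coords; by field.
Qed.

(** On coordinates the translation by -j theta moves z1 and z2 in opposite
    directions by j tau; the new last coordinate gives the Gaussian factor. *)
Lemma transl_theta (j : C) tau z1 z2 T :
  transl (- j *: theta_root R) (cartan_point tau z1 z2 T)
  = cartan_point tau (z1 - j * tau) (z2 + j * tau) (T + j ^+ 2 * tau - j * (z1 - z2)).
Proof.
rewrite !cartan_pointE.
apply/rowP => -[[|[|[|[|//]]]] ?]; cartan_coords; by field.
Qed.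

Lemma refl_theta_cartan_point tau z1 z2 T :
  refl_theta (cartan_point tau z1 z2 T) = cartan_point tau z2 z1 T.
Proof.
rewrite !cartan_pointE.
apply/rowP => -[[|[|[|[|//]]]] ?]; cartan_coords; by field.
Qed.

Lemma transl_alpha2 tau z1 z2 T :
  transl (- 2^-1 *: alpha2 R) (cartan_point tau z1 z2 T)
  = cartan_point tau (z1 - tau / 2) (z2 - tau / 2) (T + (z1 + z2) / 2 - tau / 4).
Proof.
rewrite !cartan_pointE.
apply/rowP => -[[|[|[|[|//]]]] ?]; cartan_coords; by field.
Qed.

Lemma refl_alpha2_cartan_point tau z1 z2 T :
  refl_alpha2 (cartan_point tau z1 z2 T) = cartan_point tau (- z2) (- z1) T.
Proof.
rewrite !cartan_pointE.
apply/rowP => -[[|[|[|[|//]]]] ?]; cartan_coords; by ring.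
Qed.

Lemma w0_cartan_point tau z1 z2 T : w0 (cartan_point tau z1 z2 T)
  = cartan_point tau (- z2 + tau / 2) (- z1 + tau / 2) (T + (z1 + z2) / 2 - tau / 4).
Proof.
by rewrite /w0 transl_alpha2 refl_alpha2_cartan_point !opprB ![tau / 2 - _]addrC.
Qed.

Lemma expf_alpha1 tau z1 z2 T : expf (- alpha1 R) (cartan_point tau z1 z2 T) = cexp (tpi R * z1).
Proof. by rewrite /expf cartan_pointE; cartan_coords; congr cexp; ring. Qed.

Lemma expf_weight m2 tau z1 z2 T : expf (Lambda R 1 m2 + rho R) (cartan_point tau z1 z2 T)
  = cexp (tpi R * (T + (1 - m2%:R) * z1)).
Proof.
rewrite /expf cartan_pointE /Lambda /rho; cartan_coords; congr cexp; by field.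
Qed.

Lemma tau_of_cartan_point tau z1 z2 T : tau_of (cartan_point tau z1 z2 T) = tau.
Proof.
rewrite /tau_of cartan_pointE; cartan_coords; field; exact: tpi_neq0.
Qed.

Lemma t_of_cartan_point tau z1 z2 T : t_of (cartan_point tau z1 z2 T) = T.
Proof.
rewrite /t_of cartan_pointE; cartan_coords; field; exact: tpi_neq0.
Qed.

Lemma z_of_cartan_point tau z1 z2 T : z_of (cartan_point tau z1 z2 T) = zvec z1 z2.
Proof.
rewrite /z_of tau_of_cartan_point t_of_cartan_point /cartan_point /hpoint scalerA mulVf ?tpi_neq0//.
by rewrite scale1r scaleNr [_ + tau *: _]addrC !addrA subrr add0r addrK.
Qed.

Lemma beta00 : beta R 0 0 = 0.
Proof. by rewrite /beta !mul0r oppr0 scale0r scale0r subr0. Qed.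

Lemma numer_adm_cartan_point s m2 tau z1 z2 T :
  numer_adm s 2 1 m2 0 0 (cartan_point tau z1 z2 T)
  = numer s 1 m2 (cartan_point (2 * tau) z1 z2 (T / 2)).
Proof.
rewrite /numer_adm tau_of_cartan_point z_of_cartan_point t_of_cartan_point beta00.
rewrite scaler0 addr0 /bform !mxE !(mulr0, mul0r, addr0, subr0).
by rewrite [_ * T]mulrC.
Qed.

End Cartan.

(** * Theta and Appell series in terms of exponentials *)

Section Nome.
Local Open Scope classical_set_scope.
Local Open Scope ring_scope.
Variable R : realType.
Local Notation C := (R[i] : numFieldType).
Variable t : R[i].
Hypothesis t_neg : complex.Re t < 0.
Implicit Types y : R[i].

(** With X = e^y and q = e^t this is the product over n >= 1 of
    (1 + X q^(n-1)) (1 + X^-1 q^n). *)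
Definition theta_prod y : C :=
  prod_ge1 (fun n => (1 + cexp (y + (n%:R - 1) * t)) * (1 + cexp (- y + n%:R * t)) : C).

Definition euler_prod : C := prod_ge1 (fun n => 1 - cexp (n%:R * t) : C).

Local Notation q := (cexp t : C).

Lemma nome_neq0 : q != 0. Proof. exact: cexp_neq0. Qed.

Lemma nome_lt1 : normc q < 1.
Proof. by rewrite normc_cexp expR_lt1. Qed.

Lemma prod_ge1E (u : nat -> C) : prod_ge1 u = limn (fun N => \prod_(k < N) u k.+1 : C).
Proof.
rewrite /prod_ge1; congr (lim (_ @ \oo)); apply/funext => N.
by rewrite big_add1 /= big_mkord.
Qed.

Lemma euler_prodE : euler_prod = qfact_oo q.
Proof.
rewrite /euler_prod prod_ge1E; congr (lim (_ @ \oo)); apply/funext => N.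
by apply: eq_bigr => k _; rewrite cexpMn.
Qed.

Lemma euler_prod_neq0 : euler_prod != 0.
Proof. by rewrite euler_prodE qfact_oo_neq0// nome_lt1. Qed.

Lemma cexp_shift y (k : nat) : cexp (y + k%:R * t) = cexp y * q ^+ k.
Proof. by rewrite cexpD cexpMn. Qed.

Lemma theta_prodE y : theta_prod y = qpoch_oo q (cexp y) * qpoch_oo q (q / cexp y).
Proof.
rewrite /theta_prod prod_ge1E.
have /(_ _) h := cvgM (@qpoch_oo_cvg _ _ nome_lt1 (cexp y))
  (@qpoch_oo_cvg _ _ nome_lt1 (q / cexp y)).
apply: lim_hausC; rewrite (_ : (fun N => _) = (fun n => \prod_(k < n) (1 + cexp y * q ^+ k)) \*
   (fun n => \prod_(k < n) (1 + q / cexp y * q ^+ k))); first exact: h.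
apply/funext => N /=; rewrite -big_split /=; apply: eq_bigr => k _.
have -> : k.+1%:R - 1 = k%:R :> R[i] by rewrite -natr1 addrK.
rewrite !cexp_shift cexpN exprS; congr (_ * (_ + _)); ring.
Qed.

Lemma theta_prod_neq0 y : (forall n : int, 1 + cexp (y + n%:~R * t) != 0) -> theta_prod y != 0.
Proof.
move=> h; rewrite theta_prodE mulf_neq0//; apply: qpoch_oo_neq0; try exact: nome_lt1.
  by move=> k; rewrite -cexp_shift; exact: (h k).
move=> k; have := h (Negz k); apply: contraNN => /eqP e.
have -> : 1 + cexp (y + (Negz k)%:~R * t) =
    cexp (y + (Negz k)%:~R * t) * (1 + q / cexp y * q ^+ k).
  rewrite mulrDr mulr1 addrC; congr (_ + _).
  rewrite mulrAC -exprS NegzE mulrNz mulNr cexpD cexpN -[k.+1%:~R]/(k.+1%:R) cexpMn.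
  by field; rewrite !cexp_neq0 expf_neq0// cexp_neq0.
by rewrite e mulr0.
Qed.

(** The substitution X |-> q / X exchanges the two families of factors. *)
Lemma theta_prod_sym y : theta_prod (t - y) = theta_prod y.
Proof.
rewrite !theta_prodE cexpD cexpN mulrC; congr (qpoch_oo _ _ * _).
by rewrite invfM invrK mulrA mulfV ?mul1r ?cexp_neq0.
Qed.

Lemma theta_prod_period y : theta_prod (y + tpi R) = theta_prod y.
Proof. by rewrite !theta_prodE cexpD cexp_tpi mulr1. Qed.

Lemma cexp_gprod y (k : nat) :
  cexp (k%:R * y + k%:R * (k%:R - 1) / 2 * t) = gprod q (cexp y) k.
Proof.
elim: k => [|k IH]; first by rewrite !mul0r addr0 cexp0 /gprod big_ord0.
rewrite gprodS -IH -cexp_shift -cexpD; congr cexp.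
by rewrite -natr1; field.
Qed.

(** This is X^n q^(n(n-1)/2) with X = e^y and q = e^t. *)
Definition theta_term y (n : int) : C :=
  cexp (n%:~R * y + n%:~R * (n%:~R - 1) / 2 * t).

Lemma theta_termP y (k : nat) : theta_term y k = gprod q (cexp y) k.
Proof. by rewrite -cexp_gprod. Qed.

Lemma theta_termN y (k : nat) : theta_term y (Negz k) = gprod q (q / cexp y) k.+1.
Proof.
rewrite -cexpN -cexpD -cexp_gprod; congr cexp.
by rewrite NegzE mulrNz -[k.+1%:~R]/(k.+1%:R); field.
Qed.

Lemma geom_domZ_theta y : geom_domZ (theta_term y).
Proof.
apply: geom_domZ_halves.
  by under eq_fun do rewrite theta_termP; exact: geom_dom_gprod nome_lt1 _.
by under eq_fun do rewrite theta_termN; exact: geom_dom_gprodS nome_lt1 _.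
Qed.

Lemma theta_term_sum y : sumZ (theta_term y) = euler_prod * theta_prod y.
Proof.
rewrite sumZ_pair; last 2 first.
- exact: geom_domZ_Posz (geom_domZ_theta y).
- exact: geom_domZ_Negz (geom_domZ_theta y).
under eq_fun do rewrite theta_termP theta_termN.
rewrite euler_prodE theta_prodE; apply: jacobi_triple_product nome_lt1 _ _; exact: cexp_neq0.
Qed.

(** The exponent p = 1 remains in the combination of the two modules, while p = 2
    occurs in the sum of each module, whose convergence allows adding them termwise. *)
Definition appell_term (p : nat) y (n : int) : C :=
  cexp (n%:~R * (n%:~R + 1) / 2 * t) * (1 + cexp (y + n%:~R * t))^-1 ^+ p.

Section Appell.
Variable y : R[i].
Hypothesis y_pole : forall n : int, 1 + cexp (y + n%:~R * t) != 0.

Lemma y_pole_pos (k : nat) : 1 + cexp y * q ^+ k != 0.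
Proof. by rewrite -cexp_shift; exact: (y_pole k). Qed.

Lemma cexp_shift_neg (k : nat) : cexp (y + (Negz k)%:~R * t) = cexp y / q ^+ k.+1.
Proof. by rewrite NegzE mulrNz mulNr cexpD cexpN -[k.+1%:~R]/(k.+1%:R) cexpMn. Qed.

Lemma y_pole_neg (k : nat) : 1 + cexp y / q ^+ k.+1 != 0.
Proof. by rewrite -cexp_shift_neg. Qed.

Lemma appell_termP p (k : nat) :
  appell_term p y k = gprod q q k * (1 + cexp y * q ^+ k)^-1 ^+ p.
Proof.
rewrite /appell_term -cexp_shift -cexp_gprod; congr (cexp _ * _).
by rewrite -[k%:~R]/(k%:R); field.
Qed.

Lemma appell_termN p (k : nat) :
  appell_term p y (Negz k) = gprod q q k * (1 + cexp y / q ^+ k.+1)^-1 ^+ p.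
Proof.
rewrite /appell_term -cexp_shift_neg -cexp_gprod; congr (cexp _ * _).
by rewrite NegzE mulrNz -[k.+1%:~R]/(k.+1%:R) -natr1; field.
Qed.

Lemma bounded_seqX (u : nat -> C) p : bounded_seq u -> bounded_seq (fun n => u n ^+ p).
Proof.
move=> /bounded_seq_ge0[B B0 hB]; exists (B ^+ p) => n.
by rewrite normcX lerXn2r ?nnegrE ?normc_ge0.
Qed.

Lemma geom_domZ_appell p : geom_domZ (appell_term p y).
Proof.
apply: geom_domZ_halves.
  rewrite (_ : (fun n => _) = (fun k => (1 + cexp y * q ^+ k)^-1 ^+ p * gprod q q k)).
    apply: geom_domM; last exact: geom_dom_gprod nome_lt1 _.
    by apply/bounded_seqX/bounded_inv_factor; [exact: nome_lt1|exact: y_pole_pos].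
  by apply/funext => k; rewrite appell_termP mulrC.
rewrite (_ : (fun n => _) = (fun k => (1 + cexp y / q ^+ k.+1)^-1 ^+ p * gprod q q k)).
  apply: geom_domM; last exact: geom_dom_gprod nome_lt1 _.
  apply/bounded_seqX/bounded_inv_factorN; [exact: nome_neq0|exact: nome_lt1|exact: cexp_neq0|].
  exact: y_pole_neg.
by apply/funext => k; rewrite appell_termN mulrC.
Qed.

Lemma gprod_oppq (k : nat) : gprod q (- q) k = (-1) ^+ k * gprod q q k.
Proof.
by elim: k => [|k IH]; rewrite ?gprodS ?IH ?exprS /gprod ?big_ord0 ?mulr1//; ring.
Qed.

(** The even and odd indices of the alternating series are first recombined; the
    odd ones enter as -2j - 1 instead of 2j + 1, which [sumZ_swap] corrects. *)
Lemma appell_sumZ :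
  sumZ (fun j => appell_term 1 y (- 2 * j)) - sumZ (fun j => appell_term 1 y (- 2 * j - 1))
  = euler_prod ^+ 2 / theta_prod y.
Proof.
have hd := geom_domZ_appell 1.
pose f (n : int) : C := (-1) ^+ `|n|%N * appell_term 1 y n.
have hf : geom_domZ f.
  have [A [r [r0 r1 h]]] := hd; exists A, r; split=> // n.
  by rewrite /f normcM normcX normcN normc1 expr1n mul1r.
have -> : sumZ (fun j => appell_term 1 y (- 2 * j)) = sumZ (fun j => f (2 * j)).
  rewrite -[RHS]sumZ_opp; last by apply: geom_domZ_sub => // n; lia.
  apply: eq_sumZ => n; rewrite /f mulrN mulNr abszN abszM mulnC muln2.
  by rewrite -signr_odd odd_double mul1r.
have -> : sumZ (fun j => appell_term 1 y (- 2 * j - 1)) = - sumZ (fun j => f (2 * j + 1)).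
  rewrite -[in RHS]sumZ_swap.
  have ho : geom_domZ (fun j => f (2 * (-1 - j) + 1)).
    by apply: geom_domZ_sub hf _ => n; lia.
  rewrite -sumZN//; apply: eq_sumZ => n.
  have -> : 2 * (-1 - n) + 1 = - 2 * n - 1 by lia.
  rewrite /f -signr_odd (_ : odd _ = true); last by lia.
  by rewrite expr1 mulN1r opprK.
rewrite opprK sumZ_parity // sumZ_pair; last 2 first.
- exact: geom_domZ_Posz.
- exact: geom_domZ_Negz.
rewrite (_ : (fun n => _) = (fun k => gprod q (- q) k / (1 + cexp y * q ^+ k)
                         - gprod q (- q) k / (1 + cexp y / q ^+ k.+1))).
  rewrite reciprocal_product ?euler_prodE ?theta_prodE//;
    [exact: nome_neq0|exact: nome_lt1|exact: cexp_neq0|exact: y_pole_pos|exact: y_pole_neg].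
apply/funext => k; rewrite /f appell_termP appell_termN gprod_oppq !expr1 /= exprS; ring.
Qed.

End Appell.
End Nome.

(** * Numerators, theta functions and the eta function *)

Section Numerators.
Variable R : realType.
Local Notation C := (R[i] : numFieldType).
Variable tau : R[i].
Hypothesis tau_upper : 0 < complex.Im tau.
Local Notation t := (tpi R * tau).

Lemma nome_neg : complex.Re t < 0.
Proof.
move: tau_upper; case: tau => a b b0.
by rewrite tpiE /= oppr_lt0 mulr_gt0// pmulrn_lgt0// pi_gt0.
Qed.

(** The sign is a shift of the exponent by pi i. *)
Lemma sgn_cexp (s : bool) : sgn R s = cexp (s%:R * (tpi R / 2)).
Proof. by rewrite cexpMn cexp_half. Qed.

Lemma sgn_sq (s : bool) : sgn R s * sgn R s = 1.
Proof. by case: s; rewrite /sgn ?expr1 ?expr0 ?mulrNN mulr1. Qed.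

(** With U = 1 + e^(y + n t), the terms for m2 = 1 are Gaussian over U^2.  Those for
    m2 = 0 have the further numerator s (U - 1) and split as s (1/U - 1/U^2), so
    the double poles cancel.  The map phi translates the index j of the
    translations into the index n of the Appell series. *)
Lemma Fsum_appell (s : bool) (z1 z2 T y : R[i]) (phi : int -> int) :
  (forall n : int, 1 + cexp (y + n%:~R * t) != 0) ->
  (forall j : int, (`|j| <= `|phi j|)%N) ->
  (forall j : int, tpi R * (z1 - j%:~R * (2 * tau)) + s%:R * (tpi R / 2)
     = y + (phi j)%:~R * t) ->
  (forall j : int, j%:~R ^+ 2 * (2 * tau) - j%:~R * (z1 - z2)
     = (phi j)%:~R * ((phi j)%:~R + 1) / 2 * tau) ->
  Fsum s 1 0 (cartan_point (2 * tau) z1 z2 T)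
    + sgn R s * Fsum s 1 1 (cartan_point (2 * tau) z1 z2 T)
  = sgn R s * cexp (tpi R * T) * sumZ (fun j => appell_term t 1 y (phi j)).
Proof.
move=> hy hphi h1 h2.
have d1 : geom_domZ (fun j => appell_term t 1 y (phi j)).
  exact: (geom_domZ_sub (geom_domZ_appell nome_neg hy 1) hphi).
have d2 : geom_domZ (fun j => appell_term t 2 y (phi j)).
  exact: (geom_domZ_sub (geom_domZ_appell nome_neg hy 2) hphi).
pose c := cexp (tpi R * T).
have den j : sgn R s * cexp (tpi R * (z1 - j%:~R * (2 * tau))) = cexp (y + (phi j)%:~R * t).
  by rewrite -h1 cexpD sgn_cexp mulrC.
have num j : cexp (tpi R * (T + j%:~R ^+ 2 * (2 * tau) - j%:~R * (z1 - z2)))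
    = c * cexp ((phi j)%:~R * ((phi j)%:~R + 1) / 2 * t).
  by rewrite -addrA h2 mulrDr cexpD; congr (_ * cexp _); ring.
have F1 : Fsum s 1 1 (cartan_point (2 * tau) z1 z2 T)
    = c * sumZ (fun j => appell_term t 2 y (phi j)).
  rewrite -sumZZ//; apply: eq_sumZ => j.
  rewrite transl_theta expf_weight /alpha3 expf_alpha1 den /appell_term.
  by rewrite subrr mul0r addr0 num; field; exact: hy.
have F0 : Fsum s 1 0 (cartan_point (2 * tau) z1 z2 T)
    = sgn R s * c * sumZ (fun j => appell_term t 1 y (phi j))
      - sgn R s * c * sumZ (fun j => appell_term t 2 y (phi j)).
  rewrite -mulNr -sumZ_linear //; apply: eq_sumZ => j.
  rewrite transl_theta expf_weight /alpha3 expf_alpha1 den /appell_term.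
  rewrite subr0 mul1r mulrDr (cexpD (tpi R * _)) num.
  have -> : cexp (tpi R * (z1 - j%:~R * (2 * tau))) = sgn R s * cexp (y + (phi j)%:~R * t).
    by rewrite -den mulrA sgn_sq mul1r.
  by field; exact: hy.
rewrite F0 F1 -/c; ring.
Qed.

(** When the two coordinates differ by tau, the sum runs over n = -2j and its
    reflection, which exchanges the coordinates, over n = -2j - 1. *)
Lemma numer_ddot_product (s : bool) (u T : R[i]) :
  let y := tpi R * (u + tau) + s%:R * (tpi R / 2) in
  (forall n : int, 1 + cexp (y + n%:~R * t) != 0) ->
  numer_ddot s 2 1 0 0 0 (cartan_point tau (u + tau) u T)
  = sgn R s * cexp (tpi R * (T / 2)) * (euler_prod t ^+ 2 / theta_prod t y).
Proof.
move=> y hy.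
rewrite /numer_ddot !numer_adm_cartan_point /numer !refl_theta_cartan_point.
have regroup (a b c d e : R[i]) : a - b + e * (c - d) = (a + e * c) - (b + e * d).
  by ring.
rewrite regroup.
have E1 : Fsum s 1 0 (cartan_point (2 * tau) (u + tau) u (T / 2))
    + sgn R s * Fsum s 1 1 (cartan_point (2 * tau) (u + tau) u (T / 2))
  = sgn R s * cexp (tpi R * (T / 2)) * sumZ (fun j => appell_term t 1 y (- 2 * j)).
  apply: Fsum_appell => // j.
  - by lia.
  - by rewrite rmorphM rmorphN /= /y; ring.
  - by rewrite rmorphM rmorphN /=; field.
have E2 : Fsum s 1 0 (cartan_point (2 * tau) u (u + tau) (T / 2))
    + sgn R s * Fsum s 1 1 (cartan_point (2 * tau) u (u + tau) (T / 2))
  = sgn R s * cexp (tpi R * (T / 2)) * sumZ (fun j => appell_term t 1 y (- 2 * j - 1)).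
  apply: Fsum_appell => // j.
  - by lia.
  - by rewrite rmorphB rmorphM rmorphN /= /y; ring.
  - by rewrite rmorphB rmorphM rmorphN /=; field.
apply: etrans (congr2 (fun a b => a - b) E1 E2) _.
by rewrite -mulrBr (appell_sumZ nome_neg hy).
Qed.

End Numerators.

Section Theta.
Variable R : realType.
Local Notation C := (R[i] : numFieldType).
Variable tau : R[i].
Hypothesis tau_upper : 0 < complex.Im tau.
Local Notation t := (tpi R * tau).

Lemma piC_tpi : piC R * 'i = tpi R / 2.
Proof. by rewrite /tpi mulrAC [2 * _]mulrC mulfK ?pnatr_eq0. Qed.

Lemma theta0_product b z :
  theta 0 b tau z = euler_prod t * theta_prod t (tpi R * (z + b%:R / 2) + t / 2).
Proof.
rewrite -(theta_term_sum (nome_neg tau_upper)); apply: eq_sumZ => n.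
by rewrite /theta_term piC_tpi; congr cexp; field.
Qed.

(** For a = 1 the exponents n + 1/2 are symmetric under n |-> -1 - n; applying
    [sumZ_swap] first yields the factors (1 + X q^(n-1)) (1 + X^-1 q^n) instead of
    (1 + X q^n) (1 + X^-1 q^(n-1)). *)
Lemma theta1_product b z : let w := tpi R * (z + b%:R / 2) in
  theta 1 b tau z = cexp (t / 8 - w / 2) * (euler_prod t * theta_prod t w).
Proof.
move=> w; rewrite -(theta_prod_sym (nome_neg tau_upper)) -(theta_term_sum (nome_neg tau_upper)).
rewrite -sumZZ; last exact: geom_domZ_theta (nome_neg tau_upper) _.
rewrite -[LHS]sumZ_swap; apply: eq_sumZ => n.
by rewrite /theta_term -cexpD piC_tpi rmorphB rmorphN /= /w; congr cexp; field.
Qed.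

Lemma eta_cube : eta tau ^+ 3 = cexp (t / 8) * euler_prod t ^+ 3.
Proof.
have eta_euler : eta tau = cexp (t / 24) * euler_prod t.
  rewrite /eta /qpow /e2pi; congr (cexp _ * _); first by ring.
  congr prod_ge1; apply/funext => n; congr (_ - cexp _); ring.
by rewrite eta_euler exprMn -cexpMn; congr (cexp _ * _); field.
Qed.

End Theta.

(** * The four characters *)

Section Characters.
Variable R : realType.
Local Notation C := (R[i] : numFieldType).
Variables tau z : R[i].
Hypothesis tau_upper : 0 < complex.Im tau.
Hypothesis z_not_pole : forall a b : int, 2 * z <> a%:~R + b%:~R * tau.
Local Notation t := (tpi R * tau).
Local Notation t_neg := (nome_neg tau_upper).

Lemma imag_neq0 : 'i%C != 0 :> R[i].
Proof. by rewrite eq_complex /= oner_eq0 andbF. Qed.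

Lemma imag_inv : ('i%C)^-1 = - 'i%C :> R[i].
Proof.
by apply: (mulfI imag_neq0); rewrite mulfV ?imag_neq0// mulrN -expr2 sqr_i opprK.
Qed.

Lemma cexp_quarter : cexp (tpi R / 4) = 'i%C.
Proof.
have -> : tpi R / 4 = 0 +i* (pi / 2).
  have -> : tpi R / 4 = piC R * 'i%C / 2 by rewrite piC_tpi; field.
  have -> : (2 : R[i])^-1 = (2^-1)%:C by rewrite fmorphV rmorph_nat.
  by rewrite /piC; simpc.
by rewrite /cexp /= expR0 cos_pihalf sin_pihalf; simpc.
Qed.

(** If the value were 0, the exponential of twice the argument would be 1, which
    puts 2 z into Z + Z tau. *)
Lemma pole_free (m k : int) :
  1 + cexp (tpi R * (z + m%:~R / 2 + k%:~R / 2 * tau)) != 0.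
Proof.
apply/eqP => h.
have h1 : cexp (tpi R * (z + m%:~R / 2 + k%:~R / 2 * tau)) = -1.
  by apply/eqP; rewrite -addr_eq0 addrC h.
have : cexp (tpi R * (2 * z + m%:~R + k%:~R * tau)) = 1.
  have -> : tpi R * (2 * z + m%:~R + k%:~R * tau) =
    tpi R * (z + m%:~R / 2 + k%:~R / 2 * tau) + tpi R * (z + m%:~R / 2 + k%:~R / 2 * tau).
    by field.
  by rewrite cexpD h1 mulrNN mulr1.
case/cexp_eq1 => a ha; apply: (@z_not_pole (a - m) (- k)).
by rewrite rmorphB rmorphN /= -ha; ring.
Qed.

Lemma pole_free_double (k : int) :
  1 + cexp (tpi R * (2 * z + 1%:R / 2) + k%:~R * t) != 0.
Proof.
apply/eqP => h.
have : cexp (tpi R * (2 * z + k%:~R * tau)) = 1.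
  have E : tpi R * (2 * z + 1%:R / 2) + k%:~R * t
     = tpi R * (2 * z + k%:~R * tau) + tpi R / 2 by field.
  move: h; rewrite E cexpD cexp_half mulrN1 => /eqP.
  by rewrite subr_eq0 => /eqP <-.
case/cexp_eq1 => a ha; apply: (@z_not_pole a (- k)).
by rewrite rmorphN /= -ha; ring.
Qed.

(** The theta products at half-integral powers of q, for theta_00 and theta_01. *)
Let Phalf (s : bool) := theta_prod t (tpi R * (z + s%:R / 2) + t / 2).

(** The theta products at integral powers of q, for theta_10 and theta_11. *)
Let Pint (s : bool) := theta_prod t (tpi R * (z + s%:R / 2)).

(** The theta product of theta_11(tau, 2z). *)
Let Pdouble := theta_prod t (tpi R * (2 * z + 1%:R / 2)).

Lemma Phalf_neq0 s : Phalf s != 0.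
Proof.
apply: (theta_prod_neq0 t_neg) => n.
have := pole_free s (2 * n + 1); congr (1 + cexp _ != 0).
by rewrite rmorphD rmorphM /= -[(Posz s)%:~R]/(s%:R); field.
Qed.

Lemma Pint_neq0 s : Pint s != 0.
Proof.
apply: (theta_prod_neq0 t_neg) => n.
have := pole_free s (2 * n); congr (1 + cexp _ != 0).
by rewrite rmorphM /= -[(Posz s)%:~R]/(s%:R); field.
Qed.

Lemma Pdouble_neq0 : Pdouble != 0.
Proof. apply: (theta_prod_neq0 t_neg) => n; exact: pole_free_double. Qed.

Lemma theta11_double : theta 1 1 tau (2 * z)
  = - 'i%C * cexp (t / 8) * (e2pi z)^-1 * (euler_prod t * Pdouble).
Proof.
rewrite (theta1_product tau_upper); congr (_ * _).
have -> : t / 8 - tpi R * (2 * z + 1%:R / 2) / 2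
   = t / 8 - tpi R * z - tpi R / 4 by field.
rewrite !cexpD !cexpN cexp_quarter /e2pi.
by rewrite imag_inv; ring.
Qed.

Lemma numer_untwisted s : numer_ddot s 2 1 0 0 0 (N4_point tau z)
  = sgn R s * cexp (t / 8) * (euler_prod t ^+ 2 / Phalf s).
Proof.
have -> : N4_point tau z = cartan_point tau (z - tau / 2 + tau) (z - tau / 2) (tau / 4).
  have e : z + tau / 2 = z - tau / 2 + tau by field.
  by rewrite /N4_point e.
have yE : tpi R * (z - tau / 2 + tau) + s%:R * (tpi R / 2)
   = tpi R * (z + s%:R / 2) + t / 2 by field.
rewrite (numer_ddot_product tau_upper) yE.
  by congr (_ * cexp _ * _); field.
move=> n; have := pole_free s (2 * n + 1); congr (1 + cexp _ != 0).
by rewrite rmorphD rmorphM /= -[(Posz s)%:~R]/(s%:R); field.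
Qed.

(** The twisted point has z1 = - z + tau and z2 = - z, so the numerator is a product
    at q / (s x), which [theta_prod_sym] turns into one at s x. *)
Lemma numer_twisted s : twist (numer_ddot s 2 1 0 0 0) (N4_point tau z)
  = sgn R s * e2pi (z / 2) * (euler_prod t ^+ 2 / Pint s).
Proof.
have E : w0 (N4_point tau z) = cartan_point tau (- z + tau) (- z) z.
  have e1 : - (z - tau / 2) + tau / 2 = - z + tau by field.
  have e2 : - (z + tau / 2) + tau / 2 = - z by field.
  have e3 : tau / 4 + (z + tau / 2 + (z - tau / 2)) / 2 - tau / 4 = z by field.
  by rewrite /N4_point -/(cartan_point _ _ _ _) w0_cartan_point e1 e2 e3.
pose y := tpi R * (- z + tau) + s%:R * (tpi R / 2).
have QE : theta_prod t y = Pint s.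
  have -> : y = t - (tpi R * z - s%:R * (tpi R / 2)) by rewrite /y; ring.
  rewrite (theta_prod_sym t_neg) /Pint; clear y; case: s => /=.
    by rewrite -(theta_prod_period t_neg); congr theta_prod; field.
  by congr theta_prod; field.
rewrite /twist E (numer_ddot_product tau_upper) -/y ?QE //.
move=> n; set x := tpi R * (z + (- Posz s)%:~R / 2 + (- 2 * (n + 1))%:~R / 2 * tau).
have -> : y + n%:~R * t = - x.
  by rewrite /y /x rmorphM rmorphN rmorphD rmorphN /= -[(Posz s)%:~R]/(s%:R); field.
have -> : 1 + cexp (- x) = cexp (- x) * (1 + cexp x).
  by rewrite mulrDr mulr1 -cexpD addNr cexp0 addrC.
by rewrite mulf_neq0 ?cexp_neq0 ?pole_free.
Qed.

Local Notation qn := (euler_prod t).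
Local Notation c8 := (cexp (t / 8)).

Lemma theta0E (s : bool) : theta 0 s tau z = qn * Phalf s.
Proof. exact: theta0_product. Qed.

Lemma theta10E : theta 1 0 tau z = c8 / e2pi (z / 2) * (qn * Pint false).
Proof.
rewrite (theta1_product tau_upper); congr (_ * _).
by rewrite /e2pi -cexpN -cexpD; congr cexp; field.
Qed.

Lemma theta11E : theta 1 1 tau z = - 'i%C * (c8 / e2pi (z / 2)) * (qn * Pint true).
Proof.
rewrite (theta1_product tau_upper); congr (_ * _).
rewrite -imag_inv -cexp_quarter /e2pi -!cexpN -!cexpD; congr cexp; by field.
Qed.

Lemma e2pi_half : e2pi z = e2pi (z / 2) ^+ 2.
Proof. by rewrite /e2pi -cexpMn; congr cexp; field. Qed.

Lemma factorD (a b x : R[i]) : x = a + b -> 1 + cexp a * cexp b = 1 + cexp x.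
Proof. by move=> ->; rewrite cexpD. Qed.

(** A minus sign in a factor is absorbed as +- pi i in the exponent; the sign of pi i
    differs between the factors with X and with X^-1. *)
Lemma factorBD (a b x : R[i]) : x = a + b + tpi R / 2 ->
  1 - cexp a * cexp b = 1 + cexp x.
Proof. by move=> ->; rewrite !cexpD cexp_half mulrN1. Qed.

Lemma factorBB (a b x : R[i]) : x = a + b - tpi R / 2 ->
  1 - cexp a * cexp b = 1 + cexp x.
Proof. by move=> ->; rewrite !cexpD cexpN cexp_half invrN1 mulrN1. Qed.

Lemma Dprod_Pdouble : Dprod tau z = Pdouble.
Proof.
congr prod_ge1; apply/funext => n.
by congr (_ * _); [apply: factorBD|apply: factorBB]; field.
Qed.

Lemma Phalf_prodD : prod_ge1 (fun n => (1 + e2pi z * qpow tau (n%:R - 2^-1))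
                              * (1 + e2pi (- z) * qpow tau (n%:R - 2^-1))) = Phalf false.
Proof.
congr prod_ge1; apply/funext => n.
by congr (_ * _); apply: factorD => /=; field.
Qed.

Lemma Phalf_prodB : prod_ge1 (fun n => (1 - e2pi z * qpow tau (n%:R - 2^-1))
                              * (1 - e2pi (- z) * qpow tau (n%:R - 2^-1))) = Phalf true.
Proof.
congr prod_ge1; apply/funext => n.
by congr (_ * _); [apply: factorBD|apply: factorBB] => /=; field.
Qed.

Lemma Pint_prodD : prod_ge1 (fun n => (1 + e2pi z * qpow tau (n%:R - 1))
                              * (1 + e2pi (- z) * qpow tau n%:R)) = Pint false.
Proof.
congr prod_ge1; apply/funext => n.
by congr (_ * _); apply: factorD => /=; field.
Qed.

Lemma Pint_prodB : prod_ge1 (fun n => (1 - e2pi z * qpow tau (n%:R - 1))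
                              * (1 - e2pi (- z) * qpow tau n%:R)) = Pint true.
Proof.
congr prod_ge1; apply/funext => n.
by congr (_ * _); [apply: factorBD|apply: factorBB] => /=; field.
Qed.

Lemma qpow_eighth : qpow tau (- 8%:R^-1) = c8^-1.
Proof. by rewrite -cexpN /qpow /e2pi; congr cexp; field. Qed.

Let c8_neq0 : c8 != 0. Proof. exact: cexp_neq0. Qed.
Let e_neq0 : e2pi (z / 2) != 0. Proof. exact: cexp_neq0. Qed.
Let E_neq0 : qn != 0. Proof. exact: euler_prod_neq0 t_neg. Qed.

Lemma div_imag (N X : R[i]) : N / ('i%C * X) = - 'i%C * (N / X).
Proof. by rewrite invfM imag_inv; ring. Qed.

Lemma div_Nimag (N X : R[i]) : N / (- 'i%C * X) = 'i%C * (N / X).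
Proof. by rewrite invfM invrN imag_inv opprK; ring. Qed.

Lemma theta11_double_neq0 : theta 1 1 tau (2 * z) != 0.
Proof.
rewrite theta11_double !mulf_neq0 ?invr_neq0 ?oppr_eq0 ?Pdouble_neq0 ?cexp_neq0//.
by rewrite eq_complex /= oner_eq0 andbF.
Qed.

Lemma ch_theta0 (s : bool) : ch_N4 s 2 1 0 0 0 tau z
  = 'i%C * (theta 0 s tau z / theta 1 1 tau (2 * z)).
Proof.
rewrite /ch_N4 numer_untwisted /R_N4 eta_cube.
have th0 := theta11_double_neq0; have P0 := Phalf_neq0 s.
case: s P0 => P0;
  rewrite ?div_imag ?div_Nimag ?(theta0E true) ?(theta0E false) /sgn ?expr1 ?expr0;
  by field; rewrite th0 P0 E_neq0 c8_neq0.
Qed.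

Lemma ch_tw_false : ch_N4_tw false 2 1 0 0 0 tau z
  = 'i%C * (theta 1 0 tau z / theta 1 1 tau (2 * z)).
Proof.
rewrite /ch_N4_tw numer_twisted /R_N4_tw eta_cube div_Nimag theta10E /sgn expr0.
have th0 := theta11_double_neq0; have Q0 := Pint_neq0 false.
by field; rewrite th0 Q0 E_neq0 c8_neq0 e_neq0.
Qed.

Lemma ch_tw_true : ch_N4_tw true 2 1 0 0 0 tau z
  = theta 1 1 tau z / theta 1 1 tau (2 * z).
Proof.
rewrite /ch_N4_tw numer_twisted /R_N4_tw eta_cube div_imag theta11E /sgn expr1.
have th0 := theta11_double_neq0; have Q0 := Pint_neq0 true.
transitivity ('i%C ^+ 2 * 'i%C * (c8 / e2pi (z / 2) * (qn * Pint true)) / theta 1 1 tau (2 * z)).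
  by field; rewrite th0 Q0 E_neq0 c8_neq0 e_neq0 imag_neq0.
by rewrite sqr_i mulN1r mulrA.
Qed.

Lemma theta0_quotient (s : bool) : 'i%C * (theta 0 s tau z / theta 1 1 tau (2 * z))
  = - qpow tau (- 8%:R^-1) * e2pi z * (Phalf s / Dprod tau z).
Proof.
rewrite theta11_double -2!mulrA div_Nimag mulrA -expr2 sqr_i Dprod_Pdouble qpow_eighth theta0E.
have D0 := Pdouble_neq0; have z0 : e2pi z != 0 by exact: cexp_neq0.
by field; rewrite D0 E_neq0 c8_neq0 z0.
Qed.

Lemma theta10_quotient : 'i%C * (theta 1 0 tau z / theta 1 1 tau (2 * z))
  = - e2pi (z / 2) * (Pint false / Dprod tau z).
Proof.
rewrite theta11_double -2!mulrA div_Nimag mulrA -expr2 sqr_i Dprod_Pdouble theta10E e2pi_half.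
have D0 := Pdouble_neq0.
by field; rewrite D0 E_neq0 c8_neq0 e_neq0.
Qed.

Lemma theta11_quotient : theta 1 1 tau z / theta 1 1 tau (2 * z)
  = e2pi (z / 2) * (Pint true / Dprod tau z).
Proof.
rewrite theta11_double -2!mulrA div_Nimag Dprod_Pdouble theta11E e2pi_half.
have D0 := Pdouble_neq0.
transitivity (- 'i%C ^+ 2 * (e2pi (z / 2) * (Pint true / Pdouble))).
  by field; rewrite D0 E_neq0 c8_neq0 e_neq0.
by rewrite sqr_i opprK mul1r.
Qed.

End Characters.

Theorem proposition5p7 (R : realType) (tau z : R[i])
    (tau_upper : 0 < complex.Im tau)
    (z_not_pole : forall a b : int, 2 * z <> a%:~R + b%:~R * tau) :
  let ch := fun super : bool => ch_N4 super 2 1 0 0 0 tau z in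
  let ch_tw := fun super : bool => ch_N4_tw super 2 1 0 0 0 tau z in
  let q := qpow tau in
  let D := Dprod tau z in
  (ch false = 'i%C * (theta 0 0 tau z / theta 1 1 tau (2 * z))
   /\ 'i%C * (theta 0 0 tau z / theta 1 1 tau (2 * z))
      = - q (- 8%:R^-1) * e2pi z
        * (prod_ge1 (fun n => (1 + e2pi z * q (n%:R - 2^-1))
                              * (1 + e2pi (- z) * q (n%:R - 2^-1))) / D))
  /\ (ch true = 'i%C * (theta 0 1 tau z / theta 1 1 tau (2 * z))
   /\ 'i%C * (theta 0 1 tau z / theta 1 1 tau (2 * z))
      = - q (- 8%:R^-1) * e2pi z
        * (prod_ge1 (fun n => (1 - e2pi z * q (n%:R - 2^-1))
                              * (1 - e2pi (- z) * q (n%:R - 2^-1))) / D))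
  /\ (ch_tw false = 'i%C * (theta 1 0 tau z / theta 1 1 tau (2 * z))
   /\ 'i%C * (theta 1 0 tau z / theta 1 1 tau (2 * z))
      = - e2pi (z / 2)
        * (prod_ge1 (fun n => (1 + e2pi z * q (n%:R - 1))
                              * (1 + e2pi (- z) * q n%:R)) / D))
  /\ (ch_tw true = theta 1 1 tau z / theta 1 1 tau (2 * z)
   /\ theta 1 1 tau z / theta 1 1 tau (2 * z)
      = e2pi (z / 2)
        * (prod_ge1 (fun n => (1 - e2pi z * q (n%:R - 1))
                              * (1 - e2pi (- z) * q n%:R)) / D)).
Proof.
split; last split; last split; split.
- exact: ch_theta0 false.
- by rewrite (theta0_quotient tau_upper z_not_pole false) -Phalf_prodD.
- exact: ch_theta0 true.
- by rewrite (theta0_quotient tau_upper z_not_pole true) -Phalf_prodB.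
- exact: ch_tw_false.
- by rewrite (theta10_quotient tau_upper z_not_pole) -Pint_prodD.
- exact: ch_tw_true.
- by rewrite (theta11_quotient tau_upper z_not_pole) -Pint_prodB.
Qed.
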